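(* Let $\gamma>0$ and let $r_0:\mathbb T\to\mathbb R$ be continuous. For each $n\ge 1$ let $\mu_n$ be a Borel probability measure on $\mathbb R^{\mathbb T_n}\times\mathbb R^{\mathbb T_n}$ (the initial law of $(\mathbf r(0),\mathbf p(0))$) such that $$\mathbb E_n[p_x(0)]=0,\qquad \mathbb E_n[r_x(0)]=r_0\Big(\frac xn\Big)\qquad\text{for all } x\in\mathbb T_n.$$ Let $r(t,u)$ be the solution on $\mathbb R_+\times\mathbb T$ of $$\partial_t r(t,u)=\frac1{2\gamma}\,\partial^2_{uu}r(t,u),\qquad r(0,u)=r_0(u).$$ Then, for any $G\in\mathcal C^\infty(\mathbb T)$ and any $t\in\mathbb R_+$, $$\lim_{n\to+\infty}\frac1n\sum_{x\in\mathbb T_n}G\Big(\frac xn\Big)\mathbb E_n[p_x(t)]=0,\qquad \lim_{n\to+\infty}\frac1n\sum_{x\in\mathbb T_n}G\Big(\frac xn\Big)\mathbb E_n[r_x(t)]=\int_{\mathbb T}G(u)\,r(t,u)\,\mathrm du .$$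
   Context: $\mathbb T_n=\mathbb Z/n\mathbb Z=\{0,\dots,n-1\}$ is the discrete circle and $\mathbb T=\mathbb R/\mathbb Z$ the circle of length 1. Dynamics (harmonic chain with random velocity flips, time accelerated by $n^2$): the process $(\mathbf r(t),\mathbf p(t))=(\{r_x(t)\}_{x\in\mathbb T_n},\{p_x(t)\}_{x\in\mathbb T_n})$ solves, for $x\in\mathbb T_n$, $$\mathrm d r_x(t)=n^2\big(p_x(t)-p_{x-1}(t)\big)\mathrm dt,\qquad \mathrm d p_x(t)=n^2\big(r_{x+1}(t)-r_x(t)\big)\mathrm dt-2p_x(t^-)\,\mathrm d\mathcal N_x(\gamma n^2t),$$ where $\{\mathcal N_x\}_{x\in\mathbb T_n}$ are independent Poisson processes of intensity 1, independent of the initial configuration, and $\gamma>0$ is a constant. The initial configuration has law $\mu_n$, and $\mathbb E_n$ denotes expectation for the process started from $\mu_n$. *)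

(* Defs.v *)
From HB Require Import structures.
From mathcomp Require Import all_boot all_order all_algebra.
From mathcomp Require Import all_classical all_reals all_analysis.

Set Implicit Arguments.
Unset Strict Implicit.
Unset Printing Implicit Defensive.

Import Order.TTheory GRing.Theory Num.Theory.
Import numFieldTopology.Exports numFieldNormedType.Exports.

Local Open Scope classical_set_scope.
Local Open Scope ring_scope.

(* Functions on the circle R/Z are 1-periodic functions on R, so that the     *)
(* integral over the circle is the integral over [0, 1]. Points of Z/nZ are   *)
(* ordinals x : 'I_n, with cyclic neighbours ordS x = x + 1 and               *)
(* ord_pred x = x - 1. Time ranges over R, but values at negative times play  *)
(* no role.                                                                   *)

Definition periodic1 {R : realType} (f : R -> R) : Prop :=
  forall u, f (u + 1) = f u.

Definition smooth {R : realType} (f : R -> R) : Prop :=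
  forall (k : nat) (u : R), derivable (derive1n k f) u 1.

Definition cadlag {R : realType} (f : R -> R) : Prop :=
  forall t, 0 <= t ->
    f s @[s --> t^'+] --> f t /\ (0 < t -> cvg (f s @[s --> t^'-])).

Section independence.
Context {d : measure_display} {Omega : measurableType d} {R : realType}.
Variable P : probability Omega R.

Definition mutually_independent (I : finType) (F : I -> set (set Omega)) :=
  forall (J : {set I}) (A : I -> set Omega),
    (forall i, i \in J -> F i (A i)) ->
    P (\bigcap_(i in [set` J]) A i) = (\prod_(i in J) P (A i))%E.

Definition sigma_of_var d' (T : measurableType d') (X : Omega -> T) :
  set (set Omega) := preimage_set_system setT X measurable.

Definition sigma_of_process d' (T : measurableType d') (X : R -> Omega -> T) :
  set (set Omega) := <<s \bigcup_(t in [set t | 0 <= t]) sigma_of_var (X t) >>.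

End independence.

Section poisson_process.
Context {d : measure_display} {Omega : measurableType d} {R : realType}.
Variable P : probability Omega R.

Definition counting_path (f : R -> nat) : Prop :=
  [/\ f 0 = 0%N, (forall s t, 0 <= s -> s <= t -> (f s <= f t)%N) &
      cadlag (fun t => (f t)%:R : R)].

(* The subtraction of naturals is harmless: paths are a.s. nondecreasing.     *)
Definition increment (N : R -> Omega -> nat) (s t : R) (w : Omega) : nat :=
  (N t w - N s w)%N.

Definition poisson_process (N : R -> {RV P >-> nat}) : Prop :=
  [/\ {ae P, forall w, counting_path (fun t => N t w)},
      (forall s t (k : nat), 0 <= s -> s < t ->
        P (increment N s t @^-1` [set k]) = (poisson_pmf (t - s) k)%:E) &
      (forall (k : nat) (t : nat -> R), 0 <= t 0%N ->
        (forall i, t i <= t i.+1) ->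
        mutually_independent P
          (fun i : 'I_k => sigma_of_var (increment N (t i) (t i.+1))))].

End poisson_process.

Section velocity_flip_chain.
Context {R : realType}.
Notation mu := (@lebesgue_measure R).

(* The integral of s |-> f (s-) over ]0, t] against the measure dM of a       *)
(* counting path M, i.e. the sum of f (s-) * (M s - M (s-)) over the finitely *)
(* many jump times of M.                                                      *)
Definition jump_integral (f : R -> R) (M : R -> nat) (t : R) : R :=
  \sum_(s \in `]0, t]%classic)
    lim (f u @[u --> s^'-]) *
    ((M s)%:R - lim (((M u)%:R : R) @[u --> s^'-])).

Definition flip_path (gamma : R) (n : nat) (N : 'I_n -> R -> nat)
    (r p : 'I_n -> R -> R) : Prop :=
  forall x : 'I_n,
  [/\ cadlag (r x), cadlag (p x) &
      forall t, 0 <= t ->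
        r x t = r x 0 + n%:R ^+ 2 *
          (\int[mu]_(s in `[0, t]) (p x s - p (ord_pred x) s)) /\
        p x t = p x 0 + n%:R ^+ 2 *
          (\int[mu]_(s in `[0, t]) (r (ordS x) s - r x s))
          - 2 * jump_integral (p x)
                  (fun s => N x (gamma * n%:R ^+ 2 * s)) t].

Context {d : measure_display} {Omega : measurableType d}.

Definition init_config n (r p : 'I_n -> R -> Omega -> R) (w : Omega) :
    n.-tuple R * n.-tuple R :=
  ([tuple r x 0 w | x < n], [tuple p x 0 w | x < n]).

Definition noise_sigma n (N : 'I_n -> R -> Omega -> nat)
    (r p : 'I_n -> R -> Omega -> R) (i : option 'I_n) : set (set Omega) :=
  if i is Some x then sigma_of_process (N x)
  else sigma_of_var (init_config r p).

Definition flip_chain (gamma : R) (n : nat)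
    (mu0 : probability (n.-tuple R * n.-tuple R)%type R)
    (P : probability Omega R) (N : 'I_n -> R -> {RV P >-> nat})
    (r p : 'I_n -> R -> {RV P >-> R}) : Prop :=
  [/\ (forall x, poisson_process (N x)),
      mutually_independent P (noise_sigma N r p),
      (forall A, measurable A -> P (init_config r p @^-1` A) = mu0 A) &
      {ae P, forall w, flip_path gamma (fun x t => N x t w)
               (fun x t => r x t w) (fun x t => p x t w)}].

End velocity_flip_chain.

(* Classical solutions: continuous on R_+ x T, of class C^{1,2} for t > 0.    *)
Definition heat_solution {R : realType} (kappa : R) (r0 : R -> R)
    (r : R -> R -> R) : Prop :=
  [/\ (forall t, 0 <= t -> periodic1 (r t)),
      {within [set z : R * R | 0 <= z.1],
         continuous (fun z : R * R => r z.1 z.2)},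
      (forall t u, 0 < t ->
        [/\ derivable (r ^~ u) t 1, derivable (r t) u 1 &
            derivable (derive1 (r t)) u 1] /\
        [/\ {for (t, u), continuous (fun z : R * R => derive1 (r ^~ z.2) z.1)},
            {for (t, u), continuous (fun z : R * R => derive1 (r z.1) z.2)} &
            {for (t, u), continuous (fun z : R * R => derive1n 2 (r z.1) z.2)}]),
      (forall t u, 0 < t -> derive1 (r ^~ u) t = kappa * derive1n 2 (r t) u) &
      (forall u, r 0 u = r0 u)].

(* Main.v *)
Require Import Defs.
From HB Require Import structures.
From mathcomp Require Import all_boot all_order all_algebra.
From mathcomp Require Import all_classical all_reals all_analysis.
From mathcomp Require Import measurable_realfun ring lra.

Set Implicit Arguments.
Unset Strict Implicit.
Unset Printing Implicit Defensive.

Import Order.TTheory GRing.Theory Num.Theory.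
Import numFieldTopology.Exports numFieldNormedType.Exports.

Local Open Scope classical_set_scope.
Local Open Scope ring_scope.

(* Over a time step h the flow is approximated by one explicit Euler step of the
   drift followed by the sign flips (-1)^(number of jumps) of the velocities.
   On a dyadic grid K = 2^k of [0, t] this scheme converges almost surely to the
   path as k tends to infinity: once every grid interval carries at most one jump
   per site, the local error is O(h^2) plus O(h) for each jump. The scheme is
   linear in the initial data and a polynomial in finitely many independent signs,
   of degree one in each, so its expectation is the same scheme with the signs replaced by their means,
   and dominated convergence gives E[r(t)], E[p(t)] as limits of this
   deterministic scheme.
   The Euler drift is antisymmetric and the mean signs have modulus at most 1, so
   the quadratic energy sum (r_x^2 + p_x^2) is essentially nonincreasing. Comparing
   the scheme with the profile x |-> (rho, discrete gradient of rho / (2 gamma))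
   taken at the shifted times s + a, a > 0 (where rho is C^{1,2}), the consistency
   error is small for n large; hence the mean energy distance per site at time
   t is controlled by that at time 0, which tends to 0 as n -> oo and then
   a -> 0. *)

(** * Euler scheme *)

Section scheme.
Context {R : realType} {n : nat}.
Implicit Types (c : R) (s : 'I_n -> R) (z v : ('I_n -> R) * ('I_n -> R)).

Definition flip_step c s z : ('I_n -> R) * ('I_n -> R) :=
  (fun x => z.1 x + c * (z.2 x - z.2 (ord_pred x)),
   fun x => s x * (z.2 x + c * (z.1 (ordS x) - z.1 x))).

Fixpoint flip_scheme c (s : nat -> 'I_n -> R) z (j : nat) :=
  if j is i.+1 then flip_step c (s i) (flip_scheme c s z i) else z.

Definition bounded_by (b : R) z := forall x, `|z.1 x| <= b /\ `|z.2 x| <= b.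

Lemma flip_step_bounded c s z b : 0 <= c -> (forall x, `|s x| <= 1) ->
  bounded_by b z -> bounded_by ((1 + 2 * c) * b) (flip_step c s z).
Proof.
move=> c0 s1 zb x.
have inc (a d e : R) : `|a| <= b -> `|d| <= b -> `|e| <= b ->
    `|a + c * (d - e)| <= (1 + 2 * c) * b.
  move=> ab db eb; rewrite (le_trans (ler_normD _ _))// normrM (ger0_norm c0).
  have : c * `|d - e| <= c * (b + b).
    by rewrite ler_wpM2l// (le_trans (ler_normB _ _))// lerD.
  by nra.
split => /=; first by apply: inc; apply zb.
rewrite normrM -[leRHS]mul1r ler_pM//; apply: inc; apply zb.
Qed.

Lemma flip_scheme_bounded c (s : nat -> 'I_n -> R) z b j :
  0 <= c -> (forall i x, `|s i x| <= 1) ->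
  bounded_by b z -> bounded_by ((1 + 2 * c) ^+ j * b) (flip_scheme c s z j).
Proof.
move=> c0 s1 zb; elim: j => [|j IH]; first by rewrite expr0 mul1r.
by rewrite exprS -mulrA; apply: flip_step_bounded.
Qed.

Lemma flip_scheme_perturbed c (s : nat -> 'I_n -> R)
    (Z : nat -> ('I_n -> R) * ('I_n -> R))
    (e : nat -> R) j :
  0 <= c -> (forall i x, `|s i x| <= 1) -> (forall i, 0 <= e i) ->
  (forall i x, (i < j)%N ->
    `|(Z i.+1).1 x - (flip_step c (s i) (Z i)).1 x| <= e i /\
    `|(Z i.+1).2 x - (flip_step c (s i) (Z i)).2 x| <= e i) ->
  bounded_by ((1 + 2 * c) ^+ j * \sum_(i < j) e i)
    (fun x => (Z j).1 x - (flip_scheme c s (Z 0%N) j).1 x,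
     fun x => (Z j).2 x - (flip_scheme c s (Z 0%N) j).2 x).
Proof.
move=> c0 s1 e0; elim: j => [_ x|j IH He x].
  by rewrite /= !subrr normr0 big_ord0 mulr0.
have {}IH := IH (fun i x ij => He i x (ltnW ij)).
have [/= A1 A2] := flip_step_bounded c0 (s1 j) IH x.
have [/= B1 B2] := He j x (ltnSn j).
rewrite big_ord_recr/=.
have L : (1 + 2 * c) * ((1 + 2 * c) ^+ j * \sum_(i < j) e i) + e j <=
    (1 + 2 * c) ^+ j.+1 * (\sum_(i < j) e i + e j).
  rewrite mulrA -exprS mulrDr lerD2l ler_peMl// exprn_ege1//.
  by rewrite lerDl mulr_ge0.
split; apply: le_trans L; rewrite [leRHS]addrC.
- apply: le_trans (lerD B1 A1); apply: le_trans (ler_normD _ _).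
  by rewrite le_eqVlt; apply/orP; left; apply/eqP; congr (`| _ |); ring.
- apply: le_trans (lerD B2 A2); apply: le_trans (ler_normD _ _).
  by rewrite le_eqVlt; apply/orP; left; apply/eqP; congr (`| _ |); ring.
Qed.

Definition energy z := \sum_(x < n) (z.1 x ^+ 2 + z.2 x ^+ 2).

Lemma energy_ge0 z : 0 <= energy z.
Proof. by apply: sumr_ge0 => x _; rewrite addr_ge0 ?sqr_ge0. Qed.

(* The drift is antisymmetric, so the step changes the energy only at second
   order. *)
Lemma energy_flip_step c s z : (forall x, `|s x| <= 1) ->
  energy (flip_step c s z) <= (1 + 4 * c ^+ 2) * energy z.
Proof.
case: z => r p s1.
pose D1 x := p x - p (ord_pred x); pose D2 x := r (ordS x) - r x.
have shift (F : 'I_n -> R) : \sum_(x < n) F (ordS x) = \sum_(x < n) F x.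
  by rewrite [RHS](reindex (@ordS n)) //=; apply: onW_bij; exact: ordS_bij.
apply: (@le_trans _ _ (\sum_(x < n) ((r x + c * D1 x) ^+ 2
    + (p x + c * D2 x) ^+ 2))).
  apply: ler_sum => x _; rewrite /= lerD2l exprMn -[leRHS]mul1r.
  by rewrite ler_wpM2r ?sqr_ge0// -real_normK ?num_real// expr_le1.
have cross (a b d e : R) : (a + c * (b - d)) ^+ 2 + (b + c * (e - a)) ^+ 2 =
    a ^+ 2 + b ^+ 2 + (2 * c * (e * b) - 2 * c * (a * d)) +
    c ^+ 2 * ((b - d) ^+ 2 + (e - a) ^+ 2) by ring.
have -> : \sum_(x < n) ((r x + c * D1 x) ^+ 2 + (p x + c * D2 x) ^+ 2) =
    energy (r, p) + \sum_(x < n) (2 * c * (r (ordS x) * p x)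
      - 2 * c * (r x * p (ord_pred x))) +
      c ^+ 2 * \sum_(x < n) (D1 x ^+ 2 + D2 x ^+ 2).
  rewrite /energy mulr_sumr -!big_split/=; apply: eq_bigr => x _.
  exact: cross.
have -> : \sum_(x < n) (2 * c * (r (ordS x) * p x)
      - 2 * c * (r x * p (ord_pred x))) = 0.
  rewrite big_split/= sumrN -[X in _ - X]shift.
  under [X in _ - X]eq_bigr do rewrite ordSK.
  by rewrite subrr.
rewrite addr0 mulrDl mul1r lerD2l -mulrA [leRHS]mulrCA ler_wpM2l ?sqr_ge0//.
apply: (@le_trans _ _ (\sum_(x < n) (2 * (p x ^+ 2 + p (ord_pred x) ^+ 2)
    + 2 * (r (ordS x) ^+ 2 + r x ^+ 2)))).
  apply: ler_sum => x _; rewrite /D1 /D2.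
  have := sqr_ge0 (p x + p (ord_pred x)); have := sqr_ge0 (r (ordS x) + r x).
  by nra.
rewrite /energy/= big_split/= -!mulr_sumr !big_split/= (shift (fun x => r x ^+ 2)).
rewrite -[X in 2 * (_ + X) + _]shift.
under [X in 2 * (_ + X) + _]eq_bigr do rewrite ordSK.
set A := \sum_(x < n) r x ^+ 2; set B := \sum_(x < n) p x ^+ 2.
suff : 2 * (B + B) + 2 * (A + A) <= 4 * (A + B) by [].
by lra.
Qed.

Lemma energy_perturbed c s h eta z v w : 0 <= h ->
  (forall x, `|s x| <= 1) ->
  (forall x, `|w.1 x - (flip_step c s v).1 x| <= h * eta) ->
  (forall x, `|w.2 x - (flip_step c s v).2 x| <= h * eta) ->
  energy (fun x => (flip_step c s z).1 x - w.1 x,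
          fun x => (flip_step c s z).2 x - w.2 x) <=
  (1 + h) * (1 + 4 * c ^+ 2) * energy (fun x => z.1 x - v.1 x,
                                 fun x => z.2 x - v.2 x)
    + 2 * (h + h ^+ 2) * eta ^+ 2 * n%:R.
Proof.
move=> h0 s1 w1 w2; set u := (X in _ * energy X).
have H := energy_flip_step c u s1.
have young (a b d : R) : `|b| <= h * eta -> d = a - b ->
    d ^+ 2 <= (1 + h) * a ^+ 2 + (h + h ^+ 2) * eta ^+ 2.
  move=> bh ->; have [h00|hn0] := eqVneq h 0.
    by move: bh; rewrite h00 mul0r normr_le0 => /eqP ->; lra.
  have hp : 0 < h by rewrite lt_def hn0.
  have [y by1 yy] : exists2 y, b = h * y & y ^+ 2 <= eta ^+ 2.
    exists (h^-1 * b); first by rewrite mulVKf.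
    have : `|h^-1 * b| <= eta by rewrite normrM gtr0_norm ?invr_gt0// ler_pdivrMl.
    rewrite -[X in X ^+ 2 <= _]/(h^-1 * b) => k.
    by rewrite -real_normK ?num_real// lerXn2r// nnegrE (le_trans _ k).
  rewrite by1; have := sqr_ge0 (a + y).
  have : (h + h ^+ 2) * y ^+ 2 <= (h + h ^+ 2) * eta ^+ 2.
    by rewrite ler_wpM2l// addr_ge0 ?sqr_ge0.
  move=> A B; have : 0 <= h * (a + y) ^+ 2 by rewrite mulr_ge0.
  by rewrite !expr2 in A B *; lra.
apply: (@le_trans _ _ ((1 + h) * energy (flip_step c s u) +
    2 * (h + h ^+ 2) * eta ^+ 2 * n%:R)); last first.
  by rewrite lerD2r -mulrA ler_wpM2l// addr_ge0.
rewrite /energy mulr_sumr.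
have -> : 2 * (h + h ^+ 2) * eta ^+ 2 * n%:R =
  \sum_(x < n) (2 * ((h + h ^+ 2) * eta ^+ 2)).
  by rewrite sumr_const card_ord -[RHS]mulr_natr !mulrA.
rewrite -big_split/=; apply: ler_sum => x _.
have split (a b e : R) :
  ((1 + h) * a + e) + ((1 + h) * b + e) = (1 + h) * (a + b) + 2 * e by ring.
apply: le_trans (_ : _ <= ((1 + h) * (flip_step c s u).1 x ^+ 2
    + (h + h ^+ 2) * eta ^+ 2) + ((1 + h) * (flip_step c s u).2 x ^+ 2
    + (h + h ^+ 2) * eta ^+ 2)) _; last by rewrite split.
by apply: lerD; [apply: young (w1 x) _|apply: young (w2 x) _];
  rewrite /u/=; ring.
Qed.
End scheme.

(** * Means and independence *)

Section mean.
Context {d : measure_display} {T : measurableType d} {R : realType}.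
Variable P : probability T R.
Implicit Types (X Y : T -> R) (F : set T).

Definition has_mean X (m : R) : Prop :=
  P.-integrable setT (EFin \o X) /\ (\int[P]_w (X w)%:E = m%:E)%E.

Lemma has_mean_expectation X m : measurable_fun setT X ->
  ('E_P[X] = m%:E)%E -> has_mean X m.
Proof.
rewrite unlock => mX EX; split=> //; apply/integrableP; split.
  exact/measurable_EFinP.
by rewrite integral_fin_num_abs// EX.
Qed.

Lemma has_mean_measurable X m : has_mean X m -> measurable_fun setT X.
Proof. by move=> [/measurable_int/measurable_EFinP]. Qed.

Lemma has_meanD X Y m l : has_mean X m -> has_mean Y l ->
  has_mean (fun w => X w + Y w) (m + l).
Proof.
move=> [iX EX] [iY EY]; split; first exact: (integrableD _ iX iY).
by rewrite EFinD -EX -EY -integralD.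
Qed.

Lemma has_meanZ X m (k : R) : has_mean X m -> has_mean (fun w => k * X w) (k * m).
Proof.
move=> [iX EX]; split; first exact: (integrableZl _ k iX).
by rewrite EFinM -EX -integralZl.
Qed.

Lemma has_meanB X Y m l : has_mean X m -> has_mean Y l ->
  has_mean (fun w => X w - Y w) (m - l).
Proof.
move=> hX /(has_meanZ (-1)) /(has_meanD hX).
by under eq_fun do rewrite mulN1r; rewrite mulN1r.
Qed.

Lemma ge0_integral_independent d' (T' : measurableType d') (X : {mfun T >-> T'}) F
    (f : T' -> \bar R) :
  measurable F ->
  (forall A, measurable A -> P (X @^-1` A `&` F) = (P (X @^-1` A) * P F)%E) ->
  measurable_fun setT f -> (forall y, 0 <= f y)%E ->
  (\int[P]_(w in F) f (X w) = P F * \int[P]_w f (X w))%E.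
Proof.
move=> mF XF mf f0.
have mX : measurable_fun setT X by exact: measurable_funP.
have mfX : measurable_fun setT (f \o X) by exact: measurableT_comp.
transitivity (\int[mrestr P mF]_w f (X w))%E.
  rewrite [RHS](@ge0_negligible_integral _ _ _ _ _ (~` F))//=; last 2 first.
  - exact: measurableC.
  - by rewrite /mrestr /= setICl measure0.
  rewrite setTD setCK; apply: eq_measure_integral => A mA AF.
  by rewrite /= /mrestr; apply: f_equal; apply/esym/setIidl.
rewrite -[LHS](@ge0_integral_pushforward _ _ T T' R X mX (mrestr P mF) setT)//.
have PF0 : 0 <= fine (P F) by exact: fine_ge0.
transitivity (\int[mscale (NngNum PF0) (distribution P X)]_y f y)%E.
  apply: eq_measure_integral => A mA _.
  rewrite /= /mrestr /distribution /pushforward/= XF// muleC.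
  by rewrite -[P F in LHS]fineK// fin_num_measure.
rewrite ge0_integral_mscale//= fineK ?fin_num_measure//.
by rewrite ge0_integral_distribution.
Qed.

Lemma has_mean_independent X F m (q : R) :
  has_mean X m -> measurable F ->
  (forall A, measurable A -> P (X @^-1` A `&` F) = (P (X @^-1` A) * q%:E)%E) ->
  has_mean (fun w => X w * \1_F w) (m * q).
Proof.
move=> hX mF XF; have mX := has_mean_measurable hX.
have PF : P F = q%:E.
  have := XF setT measurableT.
  by rewrite preimage_setT setTI probability_setT mul1e.
case: hX => iX EX; rewrite -PF in XF.
have iXF : P.-integrable setT (EFin \o (fun w => X w * \1_F w)).
  apply: (eq_integrable measurableT ((EFin \o X) \_ F)).
    move=> w _; rewrite /= /restrict indicE; case: ifPn => _ /=.
      by rewrite mulr1.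
    by rewrite mulr0.
  by apply/(integrable_mkcond _ mF); apply: integrableS iX.
split=> //.
transitivity (\int[P]_(w in F) (X w)%:E)%E.
  rewrite [RHS]integral_mkcond; apply: eq_integral => w _.
  by rewrite /restrict indicE; case: ifPn => _ /=; rewrite ?mulr1 ?mulr0.
have mE : measurable_fun [set: R] (@EFin R) by exact/measurable_EFinP.
pose X' : {mfun T >-> R} := HB.pack X (isMeasurableFun.Build _ _ _ _ _ mX).
have pos : ((EFin \o X)^\+ = (@EFin R)^\+ \o X)%E by rewrite funepos_comp.
have neg : ((EFin \o X)^\- = (@EFin R)^\- \o X)%E by rewrite funeneg_comp.
rewrite -[LHS]/(\int[P]_(w in F) (EFin \o X) w)%E integralE pos neg.
rewrite (ge0_integral_independent (X := X') mF XF (measurable_funepos mE)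
  (funepos_ge0 _)).
rewrite (ge0_integral_independent (X := X') mF XF (measurable_funeneg mE)
  (funeneg_ge0 _)).
rewrite -[X in (_ * X - _)%E]/(\int[P]_w ((@EFin R)^\+ \o X) w)%E -pos.
rewrite -[X in (_ - _ * X)%E]/(\int[P]_w ((@EFin R)^\- \o X) w)%E -neg.
rewrite -muleBr.
- by rewrite -integralE [X in (_ * X)%E]EX PF -EFinM mulrC.
- by rewrite PF.
- exact: integrable_add_def.
Qed.

End mean.

Section signs.
Context {d : measure_display} {T : measurableType d} {R : realType}.
Variable P : probability T R.
Variables (I : eqType) (O : I -> set T) (q : I -> R).
Hypothesis mO : forall i, measurable (O i).

Definition flip_sign (w : T) (i : I) : R := 1 - 2 * \1_(O i) w.

Definition indep_of_events (X : T -> R) := forall S : seq I, uniq S ->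
  forall A, measurable A ->
  P (X @^-1` A `&` \big[setI/setT]_(i <- S) O i) =
  (P (X @^-1` A) * (\prod_(i <- S) q i)%:E)%E.

Lemma has_mean_signs X m : has_mean P X m -> indep_of_events X ->
  forall S, uniq S ->
  has_mean P (fun w => X w * \prod_(i <- S) flip_sign w i)
             (m * \prod_(i <- S) (1 - 2 * q i)).
Proof.
move=> hX indX.
suff H S S' : uniq (S' ++ S) ->
    has_mean P (fun w => X w * \1_(\big[setI/setT]_(i <- S') O i) w
                  * \prod_(i <- S) flip_sign w i)
      (m * \prod_(i <- S') q i * \prod_(i <- S) (1 - 2 * q i)).
  move=> S uS; have := H S [::] uS; rewrite !big_nil mulr1.
  by under eq_fun do rewrite indicT mulr1.
elim: S S' => [|i S IH] S'.
  rewrite cats0 => uS'; rewrite big_nil mulr1.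
  under eq_fun do rewrite big_nil mulr1.
  apply: has_mean_independent => //; last exact: indX.
  by apply: big_ind => //; exact: measurableI.
move=> u; have u1 : uniq (S' ++ S).
  by apply: subseq_uniq u; rewrite cat_subseq// subseq_cons.
have u2 : uniq ((i :: S') ++ S).
  by move: u; rewrite -cat1s uniq_catCA.
have := has_meanB (IH _ u1) (has_meanZ 2 (IH _ u2)).
rewrite !big_cons (_ : _ - _ = m * \prod_(j <- S') q j *
  ((1 - 2 * q i) * \prod_(j <- S) (1 - 2 * q j))); last by ring.
congr has_mean; apply/funext => w; rewrite !big_cons indicI /flip_sign/=.
by ring.
Qed.

End signs.

Section scheme_mean.
Context {d : measure_display} {T : measurableType d} {R : realType} {n : nat}.
Variables (P : probability T R) (O : nat * 'I_n -> set T) (q : nat * 'I_n -> R).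
Hypothesis mO : forall i, measurable (O i).

Lemma has_mean_scheme c (Z : T -> ('I_n -> R) * ('I_n -> R))
    (m : ('I_n -> R) * ('I_n -> R)) :
  (forall x, has_mean P (fun w => (Z w).1 x) (m.1 x) /\
             has_mean P (fun w => (Z w).2 x) (m.2 x)) ->
  (forall x, indep_of_events P O q (fun w => (Z w).1 x) /\
             indep_of_events P O q (fun w => (Z w).2 x)) ->
  let Zj w := flip_scheme c (fun i y => flip_sign O w (i, y)) (Z w) in
  let mj := flip_scheme c (fun i y => 1 - 2 * q (i, y)) m in
  forall j x, has_mean P (fun w => (Zj w j).1 x) ((mj j).1 x) /\
              has_mean P (fun w => (Zj w j).2 x) ((mj j).2 x).
Proof.
move=> hZ iZ Zj mj.
(* The induction carries along the signs of later steps, which are still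
   independent of the configuration at step j. *)
suff H j S : uniq S -> (forall i, i \in S -> (j <= i.1)%N) -> forall x,
    has_mean P (fun w => (Zj w j).1 x * \prod_(i <- S) flip_sign O w i)
      ((mj j).1 x * \prod_(i <- S) (1 - 2 * q i)) /\
    has_mean P (fun w => (Zj w j).2 x * \prod_(i <- S) flip_sign O w i)
      ((mj j).2 x * \prod_(i <- S) (1 - 2 * q i)).
  move=> j x; have := H j [::] isT (fun i => ltac:(by [])) x.
  rewrite !big_nil !mulr1.
  by under eq_fun do rewrite big_nil mulr1;
     under [X in _ /\ has_mean _ X _]eq_fun do rewrite big_nil mulr1.
elim: j S => [|j IH] S uS jS x.
  by split; apply: has_mean_signs => //; [apply hZ|apply iZ|apply hZ|apply iZ].
have jS' i : i \in S -> (j <= i.1)%N by move/jS/ltnW.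
have H := IH S uS jS'.
have uS' y : uniq ((j, y) :: S).
  by rewrite /= uS andbT; apply/negP => /jS /=; rewrite ltnn.
have jS'' y i : i \in (j, y) :: S -> (j <= i.1)%N.
  by rewrite inE => /predU1P[->//|]; exact: jS'.
have H' y := IH ((j, y) :: S) (uS' y) (jS'' y).
split => /=.
- have := has_meanD (H x).1
    (has_meanZ c (has_meanB (H x).2 (H (ord_pred x)).2)).
  rewrite -mulrBl mulrA -mulrDl.
  by under eq_fun do rewrite -mulrBl mulrA -mulrDl.
- have := has_meanD (H' x x).2
    (has_meanZ c (has_meanB (H' x (ordS x)).1 (H' x x).1)).
  rewrite -mulrBl mulrA -mulrDl big_cons mulrCA mulrA.
  by under eq_fun do rewrite -mulrBl mulrA -mulrDl big_cons mulrCA mulrA.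
Qed.

End scheme_mean.

Section flip_events.
Context {d : measure_display} {T : measurableType d} {R : realType} {n : nat}.
Variables (P : probability T R).
Variables (N : 'I_n -> R -> {RV P >-> nat}) (a : R).
Hypothesis a0 : 0 <= a.
Hypothesis poisN : forall x, poisson_process (N x).

Definition grid_inc (i : nat) (y : 'I_n) : T -> nat :=
  increment (N y) (a * i%:R) (a * i.+1%:R).

Definition flip_event (i : nat * 'I_n) : set T :=
  [set w | odd (grid_inc i.1 i.2 w)].

Definition flip_prob (i : nat * 'I_n) : R := fine (P (flip_event i)).

Lemma increment_preimage (y : 'I_n) (s t : R) (B : set nat) :
  increment (N y) s t @^-1` B = \bigcup_k \bigcup_l
    (if `[< B (l - k)%N >] then N y s @^-1` [set k] `&` N y t @^-1` [set l]
     else set0).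
Proof.
apply/seteqP; split => [w Bw|w [k _ [l _]]].
  by exists (N y s w) => //; exists (N y t w) => //; rewrite asboolT.
by case: ifPn => // /asboolP Bkl [/= sk tl]; rewrite /increment/= sk tl.
Qed.

Lemma increment_sigma (y : 'I_n) (s t : R) (B : set nat) : 0 <= s -> 0 <= t ->
  sigma_of_process (N y) (increment (N y) s t @^-1` B).
Proof.
move=> s0 t0; rewrite /sigma_of_process.
set G := \bigcup_(_ in _) _.
have mN u (k : nat) : 0 <= u ->
    measurable (N y u @^-1` [set k] : set (g_sigma_algebraType G)).
  move=> u0; apply: sub_sigma_algebra; exists u => //.
  by exists [set k] => //; rewrite setTI.
suff : measurable (increment (N y) s t @^-1` B : set (g_sigma_algebraType G)).
  by [].
rewrite increment_preimage.
apply: bigcup_measurable => k _; apply: bigcup_measurable => l _.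
by case: ifPn => // _; apply: measurableI; exact: mN.
Qed.

Lemma measurable_increment (y : 'I_n) (s t : R) (B : set nat) :
  measurable (increment (N y) s t @^-1` B).
Proof.
rewrite increment_preimage.
apply: bigcup_measurable => k _; apply: bigcup_measurable => l _.
by case: ifPn => // _; apply: measurableI; exact: measurable_funPTI.
Qed.

Lemma measurable_flip_event i : measurable (flip_event i).
Proof. exact: (measurable_increment i.2 _ _ [set k | odd k]). Qed.

Lemma flip_probE i : P (flip_event i) = (flip_prob i)%:E.
Proof. by rewrite fineK// fin_num_measure//; exact: measurable_flip_event. Qed.

Lemma grid_inc_law i y k : 0 < a ->
  P (grid_inc i y @^-1` [set k]) = (a ^+ k * k`!%:R^-1 * expR (- a))%:E.
Proof.
move=> ap; have [_ law _] := poisN y.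
rewrite law ?mulr_ge0// ?ltr_pM2l ?ltr_nat//.
rewrite (_ : _ - _ = a); first by rewrite /poisson_pmf ap.
by rewrite -mulrBr -natrB// subSnn mulr1.
Qed.

Lemma grid_inc0 i y : a = 0 -> grid_inc i y = cst 0%N.
Proof.
by move=> az; apply/funext => w; rewrite /grid_inc /increment az !mul0r subnn.
Qed.

Lemma grid_inc_ge1 i y : (P [set w | (1 <= grid_inc i y w)%N] <= a%:E)%E.
Proof.
have [a00|an0] := eqVneq a 0.
  rewrite grid_inc0// (_ : [set _ | _] = set0) ?measure0 ?a00//.
  by apply/seteqP; split.
have ap : 0 < a by rewrite lt_def an0.
rewrite (_ : [set _ | _] = ~` (grid_inc i y @^-1` [set 0%N])); last first.
  by apply/seteqP; split => w /=; case: (grid_inc i y w).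
rewrite probability_setC; last exact: measurable_increment.
rewrite grid_inc_law// fact0 expr0 invr1 !mul1r -EFinB lee_fin.
have := expR_ge1Dx (- a); lra.
Qed.

Lemma grid_inc_ge2 i y : (P [set w | (2 <= grid_inc i y w)%N] <= (a ^+ 2)%:E)%E.
Proof.
have [a00|an0] := eqVneq a 0.
  rewrite grid_inc0// (_ : [set _ | _] = set0) ?measure0 ?lee_fin ?sqr_ge0//.
  by apply/seteqP; split.
have ap : 0 < a by rewrite lt_def an0.
rewrite (_ : [set _ | _] = ~` (grid_inc i y @^-1` [set 0%N] `|`
    grid_inc i y @^-1` [set 1%N])); last first.
  apply/seteqP; split => w /=; case: (grid_inc i y w) => [|[|k]]//=.
  - by move=> _ [].
  - by case; left.
  - by case; right.
rewrite probability_setC; last by apply: measurableU; exact: measurable_increment.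
have -> : P (grid_inc i y @^-1` [set 0%N] `|` grid_inc i y @^-1` [set 1%N]) =
    (P (grid_inc i y @^-1` [set 0%N]) + P (grid_inc i y @^-1` [set 1%N]))%E.
  apply: measureU; try exact: measurable_increment.
  by apply/seteqP; split => w //= [->].
rewrite !grid_inc_law// fact0 (_ : 1`! = 1%N)// expr0 expr1 invr1 !mul1r mulr1.
rewrite lee_fin; have := expR_ge1Dx (- a); have := expR_gt0 (- a); nra.
Qed.

Lemma flip_prob_bounds i :
  [/\ 0 <= flip_prob i, flip_prob i <= 1 & `|flip_prob i - a| <= a ^+ 2].
Proof.
have q0 : 0 <= flip_prob i by exact: fine_ge0.
have q1 : flip_prob i <= 1.
  by rewrite -lee_fin -flip_probE probability_le1//; exact: measurable_flip_event.
split=> //; rewrite ler_distl; apply/andP; split; last first.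
  rewrite -lee_fin -flip_probE.
  apply: (@le_trans _ _ a%:E); last by rewrite lee_fin lerDl sqr_ge0.
  apply: le_trans (grid_inc_ge1 i.1 i.2); apply: le_measure; rewrite ?inE.
  - exact: measurable_flip_event.
  - exact: (measurable_increment i.2 _ _ [set k | (1 <= k)%N]).
  - by move=> w; rewrite /flip_event /=; case: (grid_inc _ _ _).
have [a00|an0] := eqVneq a 0; first by rewrite a00 expr0n subr0.
have ap : 0 < a by rewrite lt_def an0.
rewrite -lee_fin -flip_probE.
apply: (@le_trans _ _ (P (grid_inc i.1 i.2 @^-1` [set 1%N]))).
  rewrite grid_inc_law// (_ : 1`! = 1%N)// invr1 mulr1 expr1 lee_fin.
  have := expR_ge1Dx (- a); nra.
apply: le_measure; rewrite ?inE; [exact: measurable_increment|..].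
  exact: measurable_flip_event.
by move=> w; rewrite /flip_event /= => ->.
Qed.

Lemma flip_event_indep_site (y : 'I_n) (U : seq nat) : uniq U ->
  P (\big[setI/setT]_(i <- U) flip_event (i, y)) =
  (\prod_(i <- U) flip_prob (i, y))%:E.
Proof.
move=> uU; pose k := (\max_(i <- U) i).+1.
have Uk i : i \in U -> (i < k)%N.
  by move=> iU; rewrite ltnS; exact: (@leq_bigmax_seq _ U xpredT id).
have [_ _ indep] := poisN y.
have t0 : 0 <= (fun i : nat => a * i%:R) 0%N by rewrite mulr0.
have t_nd (i : nat) : a * i%:R <= a * i.+1%:R by rewrite ler_wpM2l// ler_nat.
pose J : {set 'I_k} := [set j : 'I_k | val j \in U]%SET.
have H := indep k _ t0 t_nd J (fun j => flip_event (val j, y)).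
rewrite (_ : \big[setI/setT]_(i <- U) flip_event (i, y) =
    \bigcap_(j in [set` J]) flip_event (val j, y)).
  rewrite H; last first.
    by move=> j _; exists [set l | odd l] => //; rewrite setTI.
  rewrite (eq_bigr (fun j : 'I_k => (flip_prob (val j, y))%:E)); last first.
    by move=> j _; exact: flip_probE.
  rewrite prodEFin; congr EFin.
  rewrite (eq_bigl (fun j : 'I_k => val j \in U)); last by move=> j; rewrite inE.
  rewrite -[LHS](big_mkord (fun j => j \in U) (fun j => flip_prob (j, y))).
  rewrite -big_filter; apply: perm_big; apply: uniq_perm => //.
    by rewrite filter_uniq// iota_uniq.
  move=> j; rewrite mem_filter mem_index_iota /=.
  by case: (boolP (j \in U)) => //= /Uk ->.
rewrite -bigcap_seq; apply/seteqP; split => w Hw j /=.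
  by rewrite inE => jU; exact: Hw.
by move=> jU; apply: (Hw (Ordinal (Uk _ jU))); rewrite /= inE.
Qed.

End flip_events.

Section flip_events_independence.
Context {d : measure_display} {T : measurableType d} {R : realType} {n : nat}.
Variables (P : probability T R).
Variables (N : 'I_n -> R -> {RV P >-> nat}) (r p : 'I_n -> R -> {RV P >-> R}).
Variable a : R.
Hypothesis a0 : 0 <= a.
Hypothesis poisN : forall x, poisson_process (N x).
Hypothesis indepN : mutually_independent P (noise_sigma N r p).

Let O := flip_event N a.
Let q := flip_prob N a.

Lemma flip_event_indep_init (f : n.-tuple R * n.-tuple R -> R) :
  measurable_fun setT f ->
  indep_of_events P O q (fun w => f (init_config r p w)).
Proof.
move=> mf S uS B mB.
pose A (i : option 'I_n) : set T :=
  if i is Some y then \big[setI/setT]_(i <- S | i.2 == y) O i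
  else (fun w => f (init_config r p w)) @^-1` B.
have sA i : i \in [set: option 'I_n]%SET -> noise_sigma N r p i (A i).
  move=> _; case: i => [y|] /=; last first.
    exists (f @^-1` B); last by rewrite setTI.
    by rewrite -[X in measurable X]setTI; exact: mf.
  apply: (big_ind (fun X => sigma_of_process (N y) X)).
  - exact: (@measurableT _ (g_sigma_algebraType _)).
  - exact: (@measurableI _ (g_sigma_algebraType _)).
  - move=> [i z] /= /eqP ->.
    by apply: (@increment_sigma _ _ _ _ _ N y _ _ [set k | odd k]); rewrite mulr_ge0.
have /= := indepN sA.
have -> : \bigcap_(i in [set` [set: option 'I_n]%SET]) A i =
    (fun w => f (init_config r p w)) @^-1` B `&` \big[setI/setT]_(i <- S) O i.
  rewrite -bigcap_seq; apply/seteqP; split => [w Aw|w [wB wS] [y|]]//=.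
    split; first by apply: (Aw None); rewrite /= inE.
    move=> i iS; have := Aw (Some i.2).
    rewrite /= inE -bigcap_seq_cond => /(_ isT) /(_ i); apply.
    by rewrite /= iS eqxx.
  rewrite inE => _; rewrite -bigcap_seq_cond => i /= /andP[iS _].
  exact: wS.
move=> ->; rewrite (eq_bigl xpredT); last by move=> i; rewrite inE.
rewrite (bigD1 None)//=; congr (_ * _)%E.
rewrite (reindex_omap (op := *%E) Some id)/=; last by case.
transitivity (\prod_(y < n) (\prod_(i <- S | i.2 == y) q i)%:E)%E.
  apply: eq_big => [y|y _]; first by rewrite eqxx.
  have -> : \big[setI/setT]_(i <- S | i.2 == y) O i =
      \big[setI/setT]_(i <- [seq i.1 | i <- S & i.2 == y]) O (i, y).
    rewrite big_map big_filter; apply: eq_bigr => -[i z] /= /eqP -> //.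
  rewrite flip_event_indep_site//; last first.
    rewrite map_inj_in_uniq ?filter_uniq// => -[i1 z1] [i2 z2].
    by rewrite !mem_filter /= => /andP[/eqP-> _] /andP[/eqP-> _] ->.
  congr EFin; rewrite big_map big_filter.
  by apply: eq_bigr => -[i z] /= /eqP ->.
rewrite prodEFin; congr EFin.
rewrite (exchange_big_dep xpredT)//=; apply: eq_bigr => i _.
by rewrite (big_pred1 i.2)// => y; rewrite eq_sym.
Qed.

Lemma flip_event_indep_coord x :
  indep_of_events P O q (r x 0) /\ indep_of_events P O q (p x 0).
Proof.
split.
- have /flip_event_indep_init :
      measurable_fun setT (fun z : n.-tuple R * n.-tuple R => tnth z.1 x).
    exact: (measurableT_comp (measurable_tnth x)).
  by congr indep_of_events; apply/funext => w; rewrite /init_config /= tnth_mktuple.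
- have /flip_event_indep_init :
      measurable_fun setT (fun z : n.-tuple R * n.-tuple R => tnth z.2 x).
    exact: (measurableT_comp (measurable_tnth x)).
  by congr indep_of_events; apply/funext => w; rewrite /init_config /= tnth_mktuple.
Qed.

End flip_events_independence.

(** * Cadlag paths *)

Section cadlag_paths.
Context {R : realType}.
Notation mu := (@lebesgue_measure R).
Implicit Types (f : R -> R) (s t x l e : R).

Lemma cvg_at_right_dist f x l : f s @[s --> x^'+] --> l ->
  forall e, 0 < e -> exists2 h, 0 < h &
    forall s, x < s -> s < x + h -> `|f s - l| < e.
Proof.
move=> /cvgrPdist_lt H e /H; rewrite near_withinE => /nbhs_ballP[h /= h0 Hh].
exists h => // s xs sh; rewrite distrC; apply: (Hh s) => //.
by rewrite /ball/= ltr_distlC; apply/andP; split; lra.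
Qed.

Lemma cvg_at_left_dist f x l : f s @[s --> x^'-] --> l ->
  forall e, 0 < e -> exists2 h, 0 < h &
    forall s, s < x -> x - h < s -> `|f s - l| < e.
Proof.
move=> /cvgrPdist_lt H e /H; rewrite near_withinE => /nbhs_ballP[h /= h0 Hh].
exists h => // s xs sh; rewrite distrC; apply: (Hh s) => //.
by rewrite /ball/= ltr_distlC; apply/andP; split; lra.
Qed.

Lemma cadlag_bounded f t : cadlag f ->
  exists2 S, 0 <= S & forall s, 0 <= s -> s <= t -> `|f s| <= S.
Proof.
move=> cf; have := @segment_compact R 0 t.
move=> /compact_near_coveringP/near_covering_withinP.
move=> /(_ _ (pinfty_nbhs R) (fun S s => `|f s| <= S)).
case.
  move=> x; rewrite /= in_itv/= => /andP[x0 xt]; have [rc lc] := cf x x0.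
  have [h1 h10 H1] := cvg_at_right_dist rc ltr01.
  have [h2 [S2 [h20 H2]]] : exists h2 S2, 0 < h2 /\
      forall s, 0 <= s -> s < x -> x - h2 < s -> `|f s| <= S2.
    move: x0; rewrite le_eqVlt => /predU1P[<-|x0].
      by exists 1, 0; split=> // s s0 /(le_lt_trans s0); rewrite ltxx.
    have /cvg_at_left_dist/(_ _ ltr01)[h h0 H] := lc x0.
    exists h, (`|lim (f u @[u --> x^'-])| + 1); split=> // s _ sx xs.
    have := H _ sx xs; set l := lim _ => fl.
    have := ler_normD (f s - l) l; rewrite subrK => /le_trans; apply.
    by rewrite addrC lerD2l ltW.
  pose S0 := Num.max (`|f x| + 1) S2.
  exists (ball x (Num.min h1 h2), [set S | S0 < S]); first split => /=.
  - by apply: nbhsx_ballx; rewrite lt_min h10.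
  - exact: nbhs_pinfty_gt (num_real _).
  move=> [x' S] /= []; rewrite /ball/= ltr_distlC => /andP[xh hx] SS.
  rewrite in_itv/= => /andP[x'0 x't].
  move: SS; rewrite gt_max => /andP[S1 SS2].
  have [xx'|x'x|<-] := ltgtP x x'.
  - have /(H1 x' xx')/ltW fx : x' < x + h1.
      by apply: lt_le_trans hx _; rewrite lerD2l ge_min lexx.
    have := ler_normD (f x' - f x) (f x); rewrite subrK => /le_trans; apply.
    by rewrite addrC; apply: le_trans (ltW S1); rewrite lerD2l.
  - apply: le_trans (ltW SS2); apply: H2 => //; apply: le_lt_trans xh.
    by rewrite lerD2l lerN2 ge_min lexx orbT.
  - by apply: le_trans (ltW S1); rewrite lerDl.
move=> S [Sr HS]; exists (Num.max 0 (S + 1)); first by rewrite le_max lexx.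
move=> s s0 st; apply: (@le_trans _ _ (S + 1)); last by rewrite le_max lexx orbT.
by apply: (HS (S + 1)); rewrite ?ltrDl//= in_itv/= s0.
Qed.

Lemma cadlag_measurable f t : cadlag f -> measurable_fun `[0, t] f.
Proof.
move=> cf.
pose g (k : nat) s := f ((Num.truncn (k.+1%:R * s)).+1%:R / k.+1%:R).
apply: (@measurable_fun_cvg _ _ R _ g); last first.
  move=> s /=; rewrite in_itv/= => /andP[s0 st].
  apply/cvgrPdist_lt => e e0; have [rc _] := cf s s0.
  have [h h0 H] := cvg_at_right_dist rc e0.
  near=> k; rewrite distrC; apply: H.
    by rewrite ltr_pdivlMr// mulrC truncnS_gt.
  rewrite ltr_pdivrMr//.
  have kh : 1 < h * k.+1%:R.
    rewrite -ltr_pdivrMl// mulr1; apply: (lt_trans _ (_ : k%:R < k.+1%:R)).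
      by near: k; exact: nbhs_infty_gtr.
    by rewrite ltr_nat.
  have : (Num.truncn (k.+1%:R * s))%:R <= k.+1%:R * s by rewrite truncn_le ?mulr_ge0.
  move: kh; move: (k.+1%:R : R) => K kh; rewrite -natr1.
  by move: (Num.truncn _)%:R => m; lra.
move=> k; apply: (measurableT_comp
  (f := fun m : nat => f (m.+1%:R / k.+1%:R))
  (g := fun s => Num.truncn (k.+1%:R * s))) => //.
move=> _ B _.
rewrite (_ : _ `&` _ = \bigcup_(m in B)
   (`[0, t]%classic `&` `[m%:R / k.+1%:R, m.+1%:R / k.+1%:R[%classic)).
  by apply: bigcup_measurable => m _; exact: measurableI.
apply/seteqP; split => [s [st Bs]|s [m Bm [st sm]]]; have s0 : 0 <= s.
- by move: st; rewrite /= in_itv/= => /andP[].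
- exists (Num.truncn (k.+1%:R * s)) => //; split=> //=; rewrite in_itv/=.
  rewrite ler_pdivrMr// ltr_pdivlMr// mulrC truncn_itv// mulr_ge0//.
- by move: st; rewrite /= in_itv/= => /andP[].
- split=> //=; move: sm; rewrite /= in_itv/= ler_pdivrMr// ltr_pdivlMr// mulrC.
  by move=> /truncn_def ->.
Unshelve. all: by end_near. Qed.

Lemma cadlag_integrable f a b : cadlag f -> 0 <= a ->
  mu.-integrable `[a, b] (EFin \o f).
Proof.
move=> cf a0.
apply: (@integrableS _ _ _ mu `[0, b]) => //; first exact: subset_itvr.
apply: measurable_bounded_integrable => //=.
- by rewrite lebesgue_measure_itv/=; case: ifPn => //; rewrite ltry.
- exact: cadlag_measurable.
- have [S S0 HS] := cadlag_bounded b cf.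
  exists S; split; first exact: num_real.
  move=> S' SS' s /=; rewrite in_itv/= => /andP[s0 sb].
  by apply: le_trans (ltW SS'); exact: HS.
Qed.

Lemma cadlag_Rintegral_dist f a b k e : cadlag f -> 0 <= a -> a <= b ->
  (forall s, a <= s -> s <= b -> `|f s - k| <= e) ->
  `|\int[mu]_(s in `[0, b]) f s - \int[mu]_(s in `[0, a]) f s - (b - a) * k|
    <= (b - a) * e.
Proof.
move=> cf a0 ab fk.
rewrite (@Rintegral_itvB R f (BLeft 0) (BRight b) a) ?bnd_simp//; last first.
  exact: cadlag_integrable.
rewrite Rintegral_itv_obnd_cbnd; last first.
  apply: (@integrableS _ _ _ mu `[a, b]) => //; first exact: subset_itv_oc_cc.
  exact: cadlag_integrable.
have ab_mu : fine (mu `[a, b]) = b - a.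
  rewrite lebesgue_measure_itv/= lte_fin; move: ab; rewrite le_eqVlt.
  by case: ltgtP => // ->; rewrite subrr.
have ik (c : R) : mu.-integrable `[a, b] (EFin \o cst c).
  apply: cadlag_integrable => // x _.
  by split=> [|_]; [|apply: is_cvg_cst]; exact: cvg_cst.
have if_ : mu.-integrable `[a, b] (EFin \o f) by exact: cadlag_integrable.
have int_cst (c : R) : \int[mu]_(_ in `[a, b]) c = (b - a) * c.
  by rewrite Rintegral_cst//= ab_mu mulrC.
have ifk : mu.-integrable `[a, b] (EFin \o (fun s => f s - k)).
  exact: (integrableB _ if_ (ik k)).
rewrite -int_cst -RintegralB//; last exact: (ik k).
apply: le_trans (le_normr_Rintegral _ ifk) _ => //.
rewrite -int_cst; apply: le_Rintegral => //.
- exact: integrable_norm ifk.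
- exact: (ik e).
- by move=> s /=; rewrite in_itv/= => /andP[]; exact: fk.
Qed.
End cadlag_paths.

(** * Jumps of counting paths *)

Section jumps.
Context {R : realType}.
Variable M : R -> nat.
Hypothesis M_mono : forall s t, 0 <= s -> s <= t -> (M s <= M t)%N.
Hypothesis M_cadlag : cadlag (fun t => (M t)%:R : R).

Let left_lim (s : R) : R := lim (((M u)%:R : R) @[u --> s^'-]).

Lemma count_le_left_lim u s : 0 <= u -> u < s -> (M u)%:R <= left_lim s.
Proof.
move=> u0 us; have s0 : 0 < s by exact: le_lt_trans us.
apply: limr_ge; first by have [_] := M_cadlag (ltW s0); exact.
near=> v; rewrite ler_nat M_mono//.
by apply/ltW; near: v; exact: nbhs_left_gt.
Unshelve. all: by end_near. Qed.

Lemma left_lim_le_count s : 0 < s -> left_lim s <= (M s)%:R.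
Proof.
move=> s0; apply: limr_le; first by have [_] := M_cadlag (ltW s0); exact.
near=> v; rewrite ler_nat M_mono//.
by apply/ltW; near: v; exact: nbhs_left_gt.
Unshelve. all: by end_near. Qed.

Lemma left_lim_const a s m : a < s ->
  (forall u, a <= u -> u < s -> M u = m) -> left_lim s = m%:R.
Proof.
move=> as_ Mm; apply: cvg_lim => //; apply: cvg_near_cst.
near=> u; rewrite Mm//.
by apply/ltW; near: u; exact: nbhs_left_gt.
Unshelve. all: by end_near. Qed.

Lemma count_right_const s : 0 <= s ->
  exists2 h, 0 < h & forall u, s <= u -> u < s + h -> M u = M s.
Proof.
move=> s0; have [/cvg_at_right_dist/(_ _ ltr01)[h h0 H] _] := M_cadlag s0.
exists h => // u; rewrite le_eqVlt => /predU1P[->//|su] /(H _ su).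
have Msu := M_mono s0 (ltW su).
rewrite -natrB// ger0_norm// -[X in _ < X]/(1%:R) ltr_nat ltnS leqn0 subn_eq0.
by move=> Mus; apply/eqP; rewrite eqn_leq Mus.
Qed.

Definition jump_times (a b : R) : set R :=
  [set s | [/\ a < s, s <= b & left_lim s != (M s)%:R]].

Lemma jump_times_finite a b : 0 <= a -> finite_set (jump_times a b).
Proof.
move=> a0; apply/finite_set_leP; exists (M b).+1.
apply/pcard_leP/injfunPex; exists M.
  by move=> s [as_ sb _] /=; rewrite ltnS M_mono//; apply: le_trans (ltW as_).
have lt s t : a < s -> s < t -> left_lim t != (M t)%:R -> (M s < M t)%N.
  move=> as_ st jt; have s0 : 0 <= s by apply: le_trans a0 (ltW as_).
  rewrite ltn_neqAle M_mono ?andbT//; last exact: ltW.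
  apply: contra jt => /eqP Mst.
  rewrite eq_le left_lim_le_count; last exact: le_lt_trans st.
  by rewrite -Mst count_le_left_lim.
move=> s t /set_mem[as_ sb js] /set_mem[at_ tb jt] Mst.
have [st|ts|//] := ltgtP s t.
- by have := lt _ _ as_ st jt; rewrite Mst ltnn.
- by have := lt _ _ at_ ts js; rewrite Mst ltnn.
Qed.

Lemma jump_integralD f a b : 0 <= a -> a <= b ->
  jump_integral f M b = jump_integral f M a +
    \sum_(s \in jump_times a b) lim (f u @[u --> s^'-]) * ((M s)%:R - left_lim s).
Proof.
move=> a0 ab.
have E t : jump_integral f M t = \sum_(s \in jump_times 0 t)
    lim (f u @[u --> s^'-]) * ((M s)%:R - left_lim s).
  apply/esym/fsbig_widen => [s [s0 st _]|s].
    by rewrite /= in_itv/= s0 st.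
  rewrite /= in_itv/= => -[/andP[s0 st] /not_and3P[|/(_ st)|/negP]]//.
  by rewrite negbK -/(left_lim s) => /eqP ->; rewrite subrr mulr0.
rewrite !E (_ : jump_times 0 b = jump_times 0 a `|` jump_times a b).
  rewrite fsbigU0//; try exact: jump_times_finite.
  by move=> s [[_ sa _] [+ _ _]]; rewrite ltNge sa.
apply/seteqP; split => s.
  by move=> [s0 sb js]; case: (leP s a) => sa; [left|right].
move=> [[s0 sa js]|[as_ sb js]]; split=> //.
  exact: le_trans sa ab.
exact: le_lt_trans as_.
Qed.

Lemma jump_integral_const f a b : 0 <= a -> a <= b -> M b = M a ->
  jump_integral f M b = jump_integral f M a.
Proof.
move=> a0 ab Mab; rewrite (jump_integralD _ a0 ab) fsbig1 ?addr0//.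
move=> s [as_ sb /eqP[]]; apply: (left_lim_const as_) => u au us.
have u0 : 0 <= u by exact: le_trans au.
have s0 : 0 <= s by exact: le_trans (ltW us).
apply/eqP; rewrite eqn_leq (M_mono u0 (ltW us))/=.
by rewrite (leq_trans (M_mono s0 sb))// Mab M_mono.
Qed.

Lemma jump_integral_unit f a b : 0 <= a -> a <= b -> M b = (M a).+1 ->
  exists tau, [/\ a < tau, tau <= b,
    (forall u, a <= u -> u < tau -> M u = M a) &
    jump_integral f M b = jump_integral f M a + lim (f u @[u --> tau^'-])].
Proof.
move=> a0 ab Mab.
pose A := [set s | [/\ a <= s, s <= b & M s = M b]].
have Ab : A b by [].
have Alb : has_inf A by split; [exists b|exists a => s []].
pose tau := inf A.
have atau : a <= tau by apply: lb_le_inf; [exists b|move=> s []].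
have taub : tau <= b by apply: ge_inf => //; case: Alb.
have tau0 : 0 <= tau by exact: le_trans atau.
have before u : a <= u -> u < tau -> M u = M a.
  move=> au ut; have u0 : 0 <= u by exact: le_trans au.
  have ub : u <= b by exact: le_trans (ltW ut) taub.
  have Mau := M_mono a0 au; have Mub := M_mono u0 ub.
  apply/eqP; rewrite eqn_leq Mau andbT leqNgt; apply/negP => MM.
  have : A u by split=> //; apply/eqP; rewrite eqn_leq Mub Mab.
  by move=> /(ge_inf Alb.2); rewrite -/tau leNgt ut.
have Mtau : M tau = M b.
  have [h h0 Hh] := count_right_const tau0.
  have [s [as_ sb Ms] stau] : exists2 s, A s & s < tau + h.
    have [s As sth] := inf_adherent h0 Alb; by exists s.
  rewrite -Ms; apply/esym/Hh => //.
  by apply: ge_inf; [case: Alb|split].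
have {}atau : a < tau.
  rewrite lt_def atau andbT; apply/eqP => ta; move: Mtau; rewrite ta Mab.
  by move/eqP; rewrite eq_sym gtn_eqF.
exists tau; split=> //; rewrite (jump_integralD _ a0 ab).
have ltau : left_lim tau = (M a)%:R by exact: left_lim_const before.
have -> : jump_times a b = [set tau].
  apply/seteqP; split => s; last first.
    move=> ->; split=> //; rewrite ltau Mtau Mab eqr_nat.
    by rewrite ltn_eqF.
  move=> [as_ sb js] /=; apply/eqP; apply: contraT => stau.
  have [st|ts|/eqP] := ltgtP s tau; last by rewrite (negbTE stau).
  - move/eqP : js => []; rewrite (left_lim_const as_ (m := M a)).
      by rewrite before// ltW.
    by move=> u au us; apply: before => //; exact: lt_trans st.
  - move/eqP : js => []; rewrite (left_lim_const ts (m := M b)).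
      congr (_%:R); apply/eqP; rewrite eqn_leq -{1}Mtau !M_mono//.
        exact: le_trans (ltW ts).
      exact: ltW.
    move=> u tu us; apply/eqP; rewrite eqn_leq -{2}Mtau !M_mono//.
      exact: le_trans tu.
    by apply: le_trans sb; exact: ltW.
by rewrite fsbig_set1 ltau Mtau Mab -natr1 addrAC subrr add0r mulr1.
Qed.

End jumps.

(** * Pathwise convergence of the scheme *)

Section path_step.
Context {R : realType} {n : nat}.
Notation mu := (@lebesgue_measure R).
Variables (gamma : R) (N : 'I_n -> R -> nat) (r p : 'I_n -> R -> R).
Hypothesis gamma_ge0 : 0 <= gamma.
Hypothesis countN : forall x, counting_path (N x).
Hypothesis path : flip_path gamma N r p.

Let M (x : 'I_n) (s : R) : nat := N x (gamma * n%:R ^+ 2 * s).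

Lemma cadlagB (f g : R -> R) : cadlag f -> cadlag g -> cadlag (fun s => f s - g s).
Proof.
move=> cf cg s s0; have [rf lf] := cf s s0; have [rg lg] := cg s s0; split.
  exact: cvgB.
by move=> s1; apply: is_cvgB; [exact: lf|exact: lg].
Qed.

Lemma path_count_mono x s t : 0 <= s -> s <= t -> (M x s <= M x t)%N.
Proof.
move=> s0 st; have [_ mono _] := countN x; apply: mono.
  by rewrite !mulr_ge0// exprn_ge0.
by rewrite ler_wpM2l// mulr_ge0// exprn_ge0.
Qed.

Lemma cadlag_scale (f : R -> R) (k : R) : 0 <= k -> cadlag f ->
  cadlag (fun s => f (k * s)).
Proof.
rewrite le_eqVlt => /predU1P[<- _ s s0|k0 cf s s0].
  under [X in X @ _]eq_fun do rewrite mul0r.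
  under [X in _ /\ (_ -> cvg (X @ _))]eq_fun do rewrite mul0r.
  by rewrite mul0r; split=> [|_]; [|apply: is_cvg_cst]; exact: cvg_cst.
have ks0 : 0 <= k * s by rewrite mulr_ge0// ltW.
have [rf lf] := cf _ ks0; split.
  apply/cvgrPdist_lt => e e0; have [h h0 H] := cvg_at_right_dist rf e0.
  near=> u; rewrite distrC; apply: H.
    by rewrite ltr_pM2l//; near: u; exact: nbhs_right_gt.
  have : u < s + h / k.
    by near: u; apply: nbhs_right_lt; rewrite ltrDl divr_gt0.
  by rewrite -(ltr_pM2l k0) mulrDr [k * (h / k)]mulrCA divff ?mulr1// gt_eqF.
move=> s1; have ks1 : 0 < k * s by rewrite mulr_gt0.
apply/cvg_ex; exists (lim (f u @[u --> (k * s)^'-])).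
apply/cvgrPdist_lt => e e0; have [h h0 H] := cvg_at_left_dist (lf ks1) e0.
near=> u; rewrite distrC; apply: H.
  by rewrite ltr_pM2l//; near: u; exact: nbhs_left_lt.
have : s - h / k < u.
  by near: u; apply: nbhs_left_gt; rewrite ltrBlDr ltrDl divr_gt0.
by rewrite -(ltr_pM2l k0) mulrBr [k * (h / k)]mulrCA divff ?mulr1// gt_eqF.
Unshelve. all: by end_near. Qed.

Lemma path_count_cadlag x : cadlag (fun s => (M x s)%:R : R).
Proof.
have [_ _ cN] := countN x.
by apply: (@cadlag_scale (fun s => (N x s)%:R)) => //; rewrite mulr_ge0// exprn_ge0.
Qed.

Variables (a b S : R).
Hypothesis a_ge0 : 0 <= a.
Hypothesis ab : a <= b.
Hypothesis S_ge0 : 0 <= S.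
Hypothesis path_bounded : forall x s, a <= s -> s <= b ->
  `|r x s| <= S /\ `|p x s| <= S.

Variable c : R.
Hypothesis cE : c = n%:R ^+ 2 * (b - a).
Let c_ge0 : 0 <= c.
Proof. by rewrite cE mulr_ge0 ?exprn_ge0// subr_ge0. Qed.

Lemma drift_dist (f g : R -> R) k e s :
  cadlag f -> cadlag g -> a <= s -> s <= b -> 0 <= e ->
  (forall u, a <= u -> u <= s -> `|f u - g u - k| <= e) ->
  `|n%:R ^+ 2 * (\int[mu]_(u in `[0, s]) (f u - g u)) -
    n%:R ^+ 2 * (\int[mu]_(u in `[0, a]) (f u - g u)) - n%:R ^+ 2 * (s - a) * k|
   <= c * e.
Proof.
move=> cf cg as_ sb e0 fk.
have H := cadlag_Rintegral_dist (cadlagB cf cg) a_ge0 as_ fk.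
rewrite -mulrA -!mulrBr normrM ger0_norm ?exprn_ge0// cE -mulrA.
rewrite ler_wpM2l ?exprn_ge0//; apply: le_trans H _.
by rewrite ler_wpM2r// lerD2r.
Qed.

Lemma normB_bounded (f g : R) : `|f| <= S -> `|g| <= S -> `|f - g| <= 2 * S.
Proof.
move=> fS gS; rewrite (le_trans (ler_normB _ _))// (_ : 2 * S = S + S); last by ring.
exact: lerD.
Qed.

Lemma path_r_lip x s : a <= s -> s <= b -> `|r x s - r x a| <= 2 * S * c.
Proof.
move=> as_ sb; have s0 : 0 <= s by exact: le_trans as_.
have [_ cp eqs] := path x; have [_ cp' _] := path (ord_pred x).
have [Es _] := eqs s s0; have [Ea _] := eqs a a_ge0.
have S20 : 0 <= 2 * S by rewrite mulr_ge0.
have := @drift_dist (p x) (p (ord_pred x)) 0 _ s cp cp' as_ sb S20.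
rewrite mulr0 subr0 [c * _]mulrC Es Ea => H.
rewrite (_ : forall u v w : R, u + v - (u + w) = v - w); last first.
  by move=> *; ring.
apply: H => u au us; have ub : u <= b by exact: le_trans sb.
by rewrite subr0 normB_bounded//; have [] := path_bounded x au ub;
   have [] := path_bounded (ord_pred x) au ub.
Qed.

Lemma path_p_lip x s : a <= s -> s <= b -> M x s = M x a ->
  `|p x s - p x a| <= 2 * S * c.
Proof.
move=> as_ sb Msa; have s0 : 0 <= s by exact: le_trans as_.
have [cr _ eqs] := path x; have [cr' _ _] := path (ordS x).
have [_ Es] := eqs s s0; have [_ Ea] := eqs a a_ge0.
have S20 : 0 <= 2 * S by rewrite mulr_ge0.
have := @drift_dist (r (ordS x)) (r x) 0 _ s cr' cr as_ sb S20.
have J : jump_integral (p x) (M x) s = jump_integral (p x) (M x) a.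
  apply: jump_integral_const Msa => //.
    exact: path_count_mono.
  exact: path_count_cadlag.
rewrite mulr0 subr0 [c * _]mulrC Es Ea J => H.
rewrite (_ : forall u v w z : R, u + v - z - (u + w - z) = v - w); last first.
  by move=> *; ring.
apply: H => u au us; have ub : u <= b by exact: le_trans sb.
by rewrite subr0 normB_bounded//; have [] := path_bounded x au ub;
   have [] := path_bounded (ordS x) au ub.
Qed.

Variable J : R.
Hypothesis JE : J = (\sum_y (M y b - M y a)%N)%:R.

Lemma inc_leJ x : ((M x b - M x a)%N%:R : R) <= J.
Proof. by rewrite JE ler_nat (bigD1 x)//= leq_addr. Qed.

Let J_ge0 : 0 <= J. Proof. by rewrite JE ler0n. Qed.

Lemma path_p_dist x s : a <= s -> s <= b ->
  `|p x s - p x a| <= 2 * S * c + 2 * S * J.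
Proof.
move=> as_ sb; have [Msa|Msa] := eqVneq (M x s) (M x a).
  by rewrite (le_trans (path_p_lip as_ sb Msa))// lerDl !mulr_ge0.
have J1 : 1 <= J.
  apply: le_trans (inc_leJ x); rewrite ler1n subn_gt0.
  have Mas := path_count_mono x a_ge0 as_.
  have Msb := path_count_mono x (le_trans a_ge0 as_) sb.
  by rewrite (leq_trans _ Msb)// ltn_neqAle eq_sym Msa.
apply: (@le_trans _ _ (2 * S)).
  by apply: normB_bounded; [apply path_bounded|apply path_bounded].
have : 2 * S * 1 <= 2 * S * J by rewrite ler_wpM2l// mulr_ge0.
have : 0 <= 2 * S * c by rewrite !mulr_ge0.
lra.
Qed.

Let err : R := 4 * S * c ^+ 2 + 12 * S * c * J.

Let s (x : 'I_n) : R := 1 - 2 * (odd (M x b - M x a))%:R.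

Lemma path_step_r x :
  `|r x b - (r x a + c * (p x a - p (ord_pred x) a))| <= err.
Proof.
have b0 : 0 <= b by exact: le_trans ab.
have [_ cp eqs] := path x; have [_ cp' _] := path (ord_pred x).
have [Es _] := eqs b b0; have [Ea _] := eqs a a_ge0.
have e0 : 0 <= 2 * (2 * S * c + 2 * S * J).
  by rewrite mulr_ge0// addr_ge0// !mulr_ge0.
have := @drift_dist (p x) (p (ord_pred x)) (p x a - p (ord_pred x) a) _ b
  cp cp' ab (lexx b) e0.
rewrite -cE Es Ea => H.
rewrite (_ : forall u v w z : R, u + v - (u + w + z) = v - w - z); last first.
  by move=> *; ring.
apply: (le_trans (H _)).
  move=> u au ub; have H1 := path_p_dist x au ub.
  have H2 := path_p_dist (ord_pred x) au ub.
  rewrite (_ : forall u v w z : R, u - v - (w - z) = u - w - (v - z)); last first.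
    by move=> *; ring.
  by rewrite (le_trans (ler_normB _ _))//; lra.
rewrite /err; have : 0 <= S * c * J by rewrite !mulr_ge0.
by rewrite expr2; lra.
Qed.

Lemma path_step_p x : (M x b <= (M x a).+1)%N ->
  `|p x b - s x * (p x a + c * (r (ordS x) a - r x a))| <= err.
Proof.
move=> Mab1; have b0 : 0 <= b by exact: le_trans ab.
have Mab := path_count_mono x a_ge0 ab.
have [cr _ eqs] := path x; have [cr' _ _] := path (ordS x).
have [_ Es] := eqs b b0; have [_ Ea] := eqs a a_ge0.
have Sc0 : 0 <= 2 * S * c by rewrite !mulr_ge0.
have e0 : 0 <= 2 * (2 * S * c) by rewrite mulr_ge0.
have := @drift_dist (r (ordS x)) (r x) (r (ordS x) a - r x a) _ b
  cr' cr ab (lexx b) e0.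
rewrite -cE.
have /[swap]/[apply] H : forall u, a <= u -> u <= b ->
    `|r (ordS x) u - r x u - (r (ordS x) a - r x a)| <= 2 * (2 * S * c).
  move=> u au ub.
  rewrite (_ : forall u v w z : R, u - v - (w - z) = u - w - (v - z)); last first.
    by move=> *; ring.
  have := path_r_lip x au ub; have := path_r_lip (ordS x) au ub.
  by move=> ? ?; rewrite (le_trans (ler_normB _ _))//; lra.
have [Mba|Mba] := eqVneq (M x b) (M x a).
  have Jc : jump_integral (p x) (M x) b = jump_integral (p x) (M x) a.
    apply: jump_integral_const Mba => //.
      exact: path_count_mono.
    exact: path_count_cadlag.
  rewrite /s Mba subnn mulr0 subr0 mul1r Es Ea Jc.
  rewrite (_ : forall u v w z y : R,
    u + v - z - (u + w - z + y) = v - w - y); last first.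
    by move=> *; ring.
  apply: (le_trans H); rewrite /err.
  have : 0 <= S * c * J by rewrite !mulr_ge0.
  by rewrite expr2; lra.
have {}Mba : M x b = (M x a).+1.
  by apply/eqP; rewrite eqn_leq Mab1 ltn_neqAle eq_sym Mba.
have [tau [atau taub before Jb]] := jump_integral_unit (path_count_mono x)
  (path_count_cadlag x) (p x) a_ge0 ab Mba.
set l := lim _ in Jb.
have tau0 : 0 < tau by exact: le_lt_trans atau.
have la : `|l - p x a| <= 2 * S * c.
  apply/ler_addgt0Pr => e e_gt0.
  have [_ cp _] := path x; have [_ /(_ tau0) lp] := cp tau (ltW tau0).
  have [h h0 H'] := cvg_at_left_dist lp e_gt0.
  pose u := Num.max a (tau - h / 2).
  have au : a <= u by rewrite le_max lexx.
  have ut : u < tau by rewrite gt_max atau/= ltrBlDr ltrDl divr_gt0.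
  have /H' : tau - h < u by rewrite lt_max; apply/orP; right; lra.
  move=> /(_ ut); rewrite -/l distrC => lu.
  have := path_p_lip au (le_trans (ltW ut) taub) (before u au ut).
  have := ler_normD (l - p x u) (p x u - p x a).
  by rewrite subrKA; lra.
rewrite /s Mba subSnn mulr1 Es Ea Jb.
set A := n%:R ^+ 2 * _ in H *; set B := n%:R ^+ 2 * _ in H *.
set dr := r (ordS x) a - r x a in H *.
have rr : `|dr| <= 2 * S.
  by rewrite /dr normB_bounded//; apply path_bounded.
have cd : `|c * dr| <= 2 * S * c by rewrite normrM ger0_norm// mulrC ler_wpM2r.
have J1 : 1 <= J by apply: le_trans (inc_leJ x); rewrite Mba subSnn.
have AB : `|A - B| <= 2 * S * c.
  have S20 : 0 <= 2 * S by rewrite mulr_ge0.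
  have := @drift_dist (r (ordS x)) (r x) 0 _ b cr' cr ab (lexx b) S20.
  rewrite mulr0 subr0 [c * _]mulrC; apply.
  move=> u au ub; rewrite subr0 normB_bounded//.
    by have [] := path_bounded (ordS x) au ub.
  by have [] := path_bounded x au ub.
have Sc : 2 * S * c * 1 <= 2 * S * c * J by rewrite ler_wpM2l.
set j := jump_integral _ _ _.
apply: (@le_trans _ _ (8 * S * c)); last first.
  have : 0 <= S * c ^+ 2 by rewrite mulr_ge0 ?sqr_ge0.
  by rewrite /err; lra.
rewrite Ea -/B -/j in la.
move: (p x 0) j la AB cd => p0 j; rewrite !ler_norml.
move=> /andP[? ?] /andP[? ?] /andP[? ?].
apply/andP; split; lra.
Qed.

End path_step.

Section path_convergence.
Context {R : realType} {n : nat}.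
Variables (gamma : R) (N : 'I_n -> R -> nat) (r p : 'I_n -> R -> R) (t : R).
Hypothesis gamma_ge0 : 0 <= gamma.
Hypothesis t_ge0 : 0 <= t.
Hypothesis countN : forall x, counting_path (N x).
Hypothesis path : flip_path gamma N r p.

Let a (K : nat) : R := gamma * n%:R ^+ 2 * (t / K%:R).
Let c (K : nat) : R := n%:R ^+ 2 * (t / K%:R).
Let inc K i x : nat := (N x (a K * i.+1%:R) - N x (a K * i%:R))%N.

Let scheme K := flip_scheme (c K)
  (fun i x => 1 - 2 * (odd (inc K i x))%:R) (r^~ 0, p^~ 0) K.

Lemma expR_ge_pow (u : R) (K : nat) : 0 <= u -> (1 + u) ^+ K <= expR (u * K%:R).
Proof.
move=> u0; rewrite mulrC expRM_natl.
by rewrite lerXn2r ?nnegrE ?expR_ge0 ?addr_ge0// expR_ge1Dx.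
Qed.

Lemma path_scheme_dist : exists C, forall K, (0 < K)%N ->
  (forall i x, (i < K)%N -> (inc K i x <= 1)%N) -> forall x,
  `|r x t - (scheme K).1 x| <= C / K%:R /\ `|p x t - (scheme K).2 x| <= C / K%:R.
Proof.
have [S S0 pathS] : exists2 S : R, 0 <= S & forall x (s : R), 0 <= s -> s <= t ->
    `|r x s| <= S /\ `|p x s| <= S.
  have /all_sig2[Sr Sr0 HSr] : forall x, {S : R | 0 <= S &
      forall s : R, 0 <= s -> s <= t -> `|r x s| <= S}.
    by move=> x; apply/cid2/cadlag_bounded; have [] := path x.
  have /all_sig2[Sp Sp0 HSp] : forall x, {S : R | 0 <= S &
      forall s : R, 0 <= s -> s <= t -> `|p x s| <= S}.
    by move=> x; apply/cid2/cadlag_bounded; have [] := path x.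
  exists (\sum_x (Sr x + Sp x)); first by apply: sumr_ge0 => x _; rewrite addr_ge0.
  move=> x s s0 st; rewrite (bigD1 x)//=.
  have : 0 <= \sum_(i < n | i != x) (Sr i + Sp i).
    by apply: sumr_ge0 => y _; rewrite addr_ge0.
  by have := HSr x s s0 st; have := HSp x s s0 st; have := Sr0 x; have := Sp0 x;
    split; lra.
pose M x (s : R) := N x (gamma * n%:R ^+ 2 * s).
pose Jtot : R := (\sum_y (M y t - M y 0%R)%N)%:R.
exists (expR (2 * (n%:R ^+ 2 * t)) *
  (4 * S * (n%:R ^+ 2 * t) ^+ 2 + 12 * S * (n%:R ^+ 2 * t) * Jtot)).
move=> K K0 unit x.
have K0' : 0 < K%:R :> R by rewrite ltr0n.
have cK : c K * K%:R = n%:R ^+ 2 * t by rewrite /c -mulrA divfK// gt_eqF.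
have c0 : 0 <= c K by rewrite /c !mulr_ge0 ?exprn_ge0// invr_ge0 ltW.
pose T (i : nat) := t / K%:R * i%:R.
have T0 i : 0 <= T i by rewrite /T !mulr_ge0// invr_ge0 ltW.
have TK : T K = t by rewrite /T divfK// gt_eqF.
have TS i : T i <= T i.+1.
  by rewrite /T ler_wpM2l ?ler_nat// mulr_ge0// invr_ge0 ltW.
have Tt i : (i <= K)%N -> T i <= t.
  by move=> iK; rewrite -TK /T ler_wpM2l ?ler_nat// mulr_ge0// invr_ge0 ltW.
have cT i : c K = n%:R ^+ 2 * (T i.+1 - T i).
  by rewrite /T -mulrBr -natrB// subSnn mulr1.
have incE i y : inc K i y = (M y (T i.+1) - M y (T i))%N.
  by rewrite /inc /M /T /a !mulrA.
pose J (i : nat) : R := (\sum_y (M y (T i.+1) - M y (T i))%N)%:R.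
pose e i := 4 * S * c K ^+ 2 + 12 * S * c K * J i.
have e0 i : 0 <= e i.
  by rewrite /e addr_ge0 ?mulr_ge0 ?ler0n ?sqr_ge0.
have s1 i y : `|1 - 2 * (odd (inc K i y))%:R : R| <= 1.
  by case: odd; rewrite ?mulr1 ?mulr0 ?subr0 ?normr1// distrC;
     rewrite (_ : 2 - 1 = 1) ?normr1//; ring.
have step i y : (i < K)%N ->
    `|r y (T i.+1) - (flip_step (c K) (fun x => 1 - 2 * (odd (inc K i x))%:R)
       (r^~ (T i), p^~ (T i))).1 y| <= e i /\
    `|p y (T i.+1) - (flip_step (c K) (fun x => 1 - 2 * (odd (inc K i x))%:R)
       (r^~ (T i), p^~ (T i))).2 y| <= e i.
  move=> iK; have bdd z s : T i <= s -> s <= T i.+1 -> `|r z s| <= S /\ `|p z s| <= S.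
    move=> Tis sTi; apply: pathS; first exact: le_trans Tis.
    by apply: le_trans sTi _; exact: Tt.
  split.
    exact: (path_step_r gamma_ge0 countN path (T0 i) (TS i) S0 bdd (cT i) erefl).
  rewrite /= incE.
  apply: (path_step_p gamma_ge0 countN path (T0 i) (TS i) S0 bdd (cT i) erefl).
  by have := unit i y iK; rewrite incE leq_subLR addn1.
have := flip_scheme_perturbed (Z := fun i => (r^~ (T i), p^~ (T i))) c0 s1 e0 step.
move=> /(_ x) /=; have T00 : T 0%N = 0 by rewrite /T mulr0.
rewrite TK !T00 -/(scheme K).
have -> : \sum_(i < K) e i = (4 * S * (n%:R ^+ 2 * t) ^+ 2
    + 12 * S * (n%:R ^+ 2 * t) * Jtot) / K%:R.
  rewrite big_split/= sumr_const card_ord -mulr_sumr.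
  have -> : \sum_(i < K) J i = Jtot.
    rewrite -natr_sum exchange_big/=; congr (_%:R); apply: eq_bigr => y _.
    rewrite -(big_mkord xpredT (fun i => M y (T i.+1) - M y (T i))%N).
    rewrite telescope_sumn; first by rewrite TK /T mulr0.
    move=> i j ij; apply: path_count_mono => //.
    by rewrite /T ler_wpM2l ?ler_nat// mulr_ge0// invr_ge0 ltW.
  by rewrite -mulr_natr -cK; field; rewrite gt_eqF.
have B : (1 + 2 * c K) ^+ K <= expR (2 * (n%:R ^+ 2 * t)).
  by rewrite -cK mulrA; apply: expR_ge_pow; rewrite mulr_ge0.
have J0 : 0 <= Jtot by rewrite ler0n.
have F0 : 0 <= (4 * S * (n%:R ^+ 2 * t) ^+ 2
    + 12 * S * (n%:R ^+ 2 * t) * Jtot) / K%:R.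
  by rewrite mulr_ge0 ?invr_ge0 ?(ltW K0')// addr_ge0 ?mulr_ge0 ?sqr_ge0// exprn_ge0.
by move=> [A1 A2]; split; [apply: le_trans A1 _|apply: le_trans A2 _];
  rewrite -[leRHS]mulrA ler_wpM2r.
Qed.

End path_convergence.

(** * Means of the chain *)

Lemma cvg_dyadic_dist {R : realType} (f : nat -> R) l C :
  (\forall k \near \oo, `|l - f k| <= C / (2 ^ k)%:R) -> f k @[k --> \oo] --> l.
Proof.
move=> H; apply/cvgrPdist_lt => e e0; near=> k.
have Hk : `|l - f k| <= C / (2 ^ k)%:R by near: k.
apply: (le_lt_trans Hk); rewrite ltr_pdivrMr ?ltr0n ?expn_gt0//.
apply: (le_lt_trans (ler_norm C)); rewrite mulrC -ltr_pdivrMr//.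
apply: (@lt_trans _ _ k%:R); first by near: k; exact: nbhs_infty_gtr.
by rewrite ltr_nat ltn_expl.
Unshelve. all: by end_near. Qed.

Section chain_means.
Context {d : measure_display} {T : measurableType d} {R : realType} {n : nat}.
Variables (gamma : R) (mu0 : probability (n.-tuple R * n.-tuple R)%type R).
Variables (P : probability T R).
Variables (N : 'I_n -> R -> {RV P >-> nat}) (r p : 'I_n -> R -> {RV P >-> R}).
Hypothesis gamma_ge0 : 0 <= gamma.
Hypothesis chain : flip_chain gamma mu0 N r p.
Variable t : R.
Hypothesis t_ge0 : 0 <= t.

Definition flip_rate (K : nat) : R := gamma * n%:R ^+ 2 * (t / K%:R).

Let a := flip_rate.
Let c (K : nat) : R := n%:R ^+ 2 * (t / K%:R).

Lemma flip_rate_ge0 K : 0 <= a K.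
Proof. by rewrite /a !mulr_ge0 ?exprn_ge0// invr_ge0. Qed.

Lemma grid_inc_nested k l i x w : counting_path (fun s => N x s w) ->
  (k <= l)%N -> (i < 2 ^ l)%N ->
  exists2 j, (j < 2 ^ k)%N &
    (grid_inc N (a (2 ^ l)) i x w <= grid_inc N (a (2 ^ k)) j x w)%N.
Proof.
move=> cw kl il; have [_ mono _] := cw; pose q := (2 ^ (l - k))%N.
have q0 : (0 < q)%N by rewrite expn_gt0.
have lE : (2 ^ l = 2 ^ k * q)%N by rewrite -expnD subnKC.
exists (i %/ q)%N; first by rewrite ltn_divLR// -lE.
have aE : a (2 ^ k) = a (2 ^ l) * q%:R.
  rewrite /a /flip_rate lE natrM -!mulrA; congr (_ * (_ * (_ * _))).
  by rewrite invfM -mulrA mulVf ?mulr1// pnatr_eq0 -lt0n.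
have al := flip_rate_ge0 (2 ^ l).
rewrite aE; move: (a (2 ^ l)) al => A A0.
rewrite /grid_inc /increment -!mulrA -!natrM.
apply: leq_sub; apply: mono; try by rewrite mulr_ge0.
  by apply: ler_wpM2l => //; rewrite ler_nat mulnC ltn_ceil.
by apply: ler_wpM2l => //; rewrite ler_nat mulnC leq_trunc_div.
Qed.

Lemma eventually_simple_inc x : {ae P, forall w, exists k,
  forall i, (i < 2 ^ k)%N -> (grid_inc N (a (2 ^ k)) i x w <= 1)%N}.
Proof.
have [pois _ _ _] := chain.
pose B k := \big[setU/set0]_(i < 2 ^ k)
  [set w | (2 <= grid_inc N (a (2 ^ k)) i x w)%N].
have mBi k i : measurable [set w | (2 <= grid_inc N (a (2 ^ k)) i x w)%N].
  exact: (measurable_increment _ x _ _ [set m | (2 <= m)%N]).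
have mB k : measurable (B k) by exact: bigsetU_measurable.
have PB k : (P (B k) <= (a 1 ^+ 2 / (2 ^ k)%:R)%:E)%E.
  apply: (@le_trans _ _ (\sum_(i < 2 ^ k)
      P [set w | (2 <= grid_inc N (a (2 ^ k)) i x w)%N])%E).
    by apply: (@Boole_inequality _ _ _ P
      (fun i => [set w | (2 <= grid_inc N (a (2 ^ k)) i x w)%N])).
  apply: (@le_trans _ _ (\sum_(i < 2 ^ k) (a (2 ^ k) ^+ 2)%:E)%E).
    by apply: lee_sum => i _; apply: grid_inc_ge2 => //; exact: flip_rate_ge0.
  rewrite sumEFin lee_fin sumr_const card_ord -mulr_natr.
  rewrite /a /flip_rate divr1 le_eqVlt; apply/orP; left; apply/eqP.
  by field; rewrite pnatr_eq0 -lt0n expn_gt0.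
(* P (B k) = O(2^-k), so no nesting is needed for the intersection to be null. *)
exists (\bigcap_k B k); split.
- exact: bigcap_measurable.
- apply/eqP; rewrite eq_le measure_ge0 andbT; apply/lee_addgt0Pr => e e0.
  rewrite add0e; pose C := a 1 ^+ 2.
  have /cvgrPdist_lt/(_ _ e0)[k _ Hk] : C / (2 ^ k)%:R @[k --> \oo] --> (0 : R).
    apply: (@cvg_dyadic_dist _ _ _ C); near=> k.
    by rewrite sub0r normrN ger0_norm// mulr_ge0 ?sqr_ge0.
  apply: (@le_trans _ _ (P (B k))).
    by apply: le_measure; rewrite ?inE//; [exact: bigcap_measurable|exact: bigcap_inf].
  apply: (le_trans (PB k)); rewrite lee_fin.
  have := Hk k (leqnn k); rewrite sub0r normrN => /ltW; apply: le_trans.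
  exact: ler_norm.
- move=> w /= /forallNP H k _; have := H k => /existsNP[i].
  move=> /not_implyP[ik /negP]; rewrite -ltnNge => Hi.
  rewrite /B -(bigcup_mkord _
    (fun i => [set w | (2 <= grid_inc N (a (2 ^ k)) i x w)%N])).
  by exists i.
Unshelve. all: by end_near. Qed.

Variable m : ('I_n -> R) * ('I_n -> R).
Hypothesis mean_r : forall x, ('E_P[r x 0%R] = (m.1 x)%:E)%E.
Hypothesis mean_p : forall x, ('E_P[p x 0%R] = (m.2 x)%:E)%E.

Definition mean_scheme (K : nat) : ('I_n -> R) * ('I_n -> R) :=
  flip_scheme (n%:R ^+ 2 * (t / K%:R))
    (fun i y => 1 - 2 * flip_prob N (flip_rate K) (i, y)) m K.

Let Z (w : T) : ('I_n -> R) * ('I_n -> R) := (fun x => r x 0 w, fun x => p x 0 w).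

Let Zk (K : nat) (w : T) := flip_scheme (c K)
  (fun i y => flip_sign (flip_event N (a K)) w (i, y)) (Z w) K.

Let mean_init x : has_mean P (fun w => (Z w).1 x) (m.1 x) /\
             has_mean P (fun w => (Z w).2 x) (m.2 x).
Proof.
split; [apply: (has_mean_expectation _ (mean_r x))
       |apply: (has_mean_expectation _ (mean_p x))].
- exact: (measurable_funP (r x 0)).
- exact: (measurable_funP (p x 0)).
Qed.

Lemma mean_schemeP K x : has_mean P (fun w => (Zk K w).1 x) ((mean_scheme K).1 x) /\
  has_mean P (fun w => (Zk K w).2 x) ((mean_scheme K).2 x).
Proof.
have [pois indep _ _] := chain.
apply: has_mean_scheme => //.
- by move=> i; exact: measurable_flip_event.
- by move=> y; apply: flip_event_indep_coord => //; exact: flip_rate_ge0.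
Qed.

Let bound (w : T) : R :=
  expR (2 * (n%:R ^+ 2 * t)) * \sum_(y < n) (`|r y 0 w| + `|p y 0 w|).

Lemma bound_integrable : P.-integrable setT (EFin \o bound).
Proof.
rewrite (_ : _ \o _ = (fun w => (expR (2 * (n%:R ^+ 2 * t)))%:E *
    \sum_(y < n) ((EFin \o (Num.norm \o r y 0)) w +
                  (EFin \o (Num.norm \o p y 0)) w))%E).
  apply: integrableZl => //; apply: integrable_sum => // y _.
  have [[ir _] [ip _]] := mean_init y.
  by apply: integrableD => //; [exact: integrable_norm ir|exact: integrable_norm ip].
by apply/funext => w; rewrite /= /bound EFinM -sumEFin.
Qed.

Lemma Zk_bounded K w x : (0 < K)%N ->
  `|(Zk K w).1 x| <= bound w /\ `|(Zk K w).2 x| <= bound w.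
Proof.
move=> K0; have c0 : 0 <= c K by rewrite /c !mulr_ge0 ?exprn_ge0// invr_ge0.
have s1 i y : `|flip_sign (flip_event N (a K)) w (i, y) : R| <= 1.
  rewrite /flip_sign indicE; case: (_ \in _); rewrite ?mulr1 ?mulr0 ?subr0 ?normr1//.
  by rewrite distrC (_ : 2 - 1 = 1) ?normr1//; ring.
set b := \sum_(y < n) (`|r y 0 w| + `|p y 0 w|).
have Zb : bounded_by b (Z w).
  move=> y; rewrite /b (bigD1 y)//=.
  have : 0 <= \sum_(i < n | i != y) (`|r i 0 w| + `|p i 0 w|).
    by apply: sumr_ge0 => i _; rewrite addr_ge0.
  by have := normr_ge0 (r y 0 w); have := normr_ge0 (p y 0 w); split; lra.
have b0 : 0 <= b by apply: sumr_ge0 => i _; rewrite addr_ge0.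
have cK : c K * K%:R = n%:R ^+ 2 * t.
  by rewrite /c -mulrA divfK// pnatr_eq0 -lt0n.
have B : (1 + 2 * c K) ^+ K * b <= bound w.
  rewrite /bound -/b ler_wpM2r// -cK mulrA; apply: expR_ge_pow.
  by rewrite mulr_ge0.
have [H1 H2] := flip_scheme_bounded K c0 s1 Zb x.
by split; [apply: le_trans H1 B|apply: le_trans H2 B].
Qed.

Lemma Zk_cvg : {ae P, forall w, forall x,
  (Zk (2 ^ k) w).1 x @[k --> \oo] --> r x t w /\
  (Zk (2 ^ k) w).2 x @[k --> \oo] --> p x t w}.
Proof.
have [pois _ _ path] := chain.
have FF := ae_filter_ringOfSetsType P.
have count : {ae P, forall w, forall x, counting_path (fun s => N x s w)}.
  by apply: filter_forall => x; have [] := pois x.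
have simple : {ae P, forall w, forall x, exists k,
  forall i, (i < 2 ^ k)%N -> (grid_inc N (a (2 ^ k)) i x w <= 1)%N}.
  by apply: filter_forall; exact: eventually_simple_inc.
apply: filterS2 (filterI count simple) path => w [cw sw] pw x.
have [k0 Hk0] := all_sig (fun y => cid (sw y)).
have [C HC] := path_scheme_dist gamma_ge0 t_ge0 cw pw.
have H k : (\max_y k0 y <= k)%N ->
    `|r x t w - (Zk (2 ^ k) w).1 x| <= C / (2 ^ k)%:R /\
    `|p x t w - (Zk (2 ^ k) w).2 x| <= C / (2 ^ k)%:R.
  move=> kk; have := HC (2 ^ k)%N; rewrite expn_gt0 => /(_ isT) H.
  have := H _ x; rewrite /Zk.
  have -> : (fun (i : nat) (y : 'I_n) =>
      flip_sign (flip_event N (a (2 ^ k))) w (i, y) : R) =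
    (fun i y => 1 - 2 * (odd (N y (gamma * n%:R ^+ 2 * (t / (2 ^ k)%:R) * i.+1%:R) w
      - N y (gamma * n%:R ^+ 2 * (t / (2 ^ k)%:R) * i%:R) w))%:R).
    apply/funext => i; apply/funext => y; rewrite /flip_sign indicE.
    congr (1 - 2 * (nat_of_bool _)%:R); rewrite /flip_event /grid_inc /increment /=.
    by apply/idP/idP; rewrite inE.
  apply=> i y ik.
  have [j jk] := grid_inc_nested (cw y) (leq_trans (leq_bigmax y) kk) ik.
  by move=> /leq_trans; apply; exact: Hk0.
by split; apply: (@cvg_dyadic_dist _ _ _ C);
  exists (\max_y k0 y)%N => // k /= kk; have [] := H k kk.
Unshelve. all: by end_near. Qed.

Lemma chain_means : exists z : ('I_n -> R) * ('I_n -> R), forall x,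
  [/\ ('E_P[r x t] = (z.1 x)%:E)%E, ('E_P[p x t] = (z.2 x)%:E)%E,
      (mean_scheme (2 ^ k)).1 x @[k --> \oo] --> z.1 x &
      (mean_scheme (2 ^ k)).2 x @[k --> \oo] --> z.2 x].
Proof.
have main (X : {RV P >-> R}) (f : nat -> T -> R) (l : nat -> R) :
    (forall k, has_mean P (f k) (l k)) ->
    (forall k w, `|f k w| <= bound w) ->
    {ae P, forall w, f k w @[k --> \oo] --> X w} ->
    exists z, ('E_P[X] = z%:E)%E /\ l k @[k --> \oo] --> z.
  move=> fl fb fX.
  have [iX _ H] : [/\ P.-integrable setT (EFin \o X),
     [sequence (\int[P]_w `|(EFin \o f n) w - (EFin \o X) w|)%E]_n @ \oo --> 0%E &
     [sequence (\int[P]_w (EFin \o f n) w)%E]_n @ \oo --> (\int[P]_w (EFin \o X) w)%E].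
    apply: (@dominated_convergence _ _ _ P setT measurableT
       (fun k => EFin \o f k) (EFin \o X) (EFin \o bound)).
    - by move=> k; apply/measurable_EFinP/has_mean_measurable/fl.
    - by apply/measurable_EFinP; exact: measurable_funP.
    - apply: filterS fX => w fw _; apply/fine_cvgP; split; last exact: fw.
      by apply: nearW.
    - exact: bound_integrable.
    - by apply: aeW => w k _; rewrite /= lee_fin.
  have iz : (\int[P]_w (EFin \o X) w)%E \is a fin_num by exact: integrable_fin_num.
  exists (fine (\int[P]_w (EFin \o X) w)%E); split.
    by rewrite unlock fineK.
  have -> : l = fine \o (fun k => \int[P]_w (EFin \o f k) w)%E.
    by apply/funext => k; have [_ /= ->] := fl k.
  by apply: fine_cvg; rewrite fineK.
have K0 k : (0 < 2 ^ k)%N by rewrite expn_gt0.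
have /all_sig[zr Hr] : forall x, {z | ('E_P[r x t] = z%:E)%E /\
    (mean_scheme (2 ^ k)).1 x @[k --> \oo] --> z}.
  move=> x; apply/cid/(main _ (fun k w => (Zk (2 ^ k) w).1 x)).
  - by move=> k; exact: (mean_schemeP _ _).1.
  - by move=> k w; exact: (Zk_bounded _ _ (K0 k)).1.
  - by apply: filterS Zk_cvg => w /(_ x)[].
have /all_sig[zp Hp] : forall x, {z | ('E_P[p x t] = z%:E)%E /\
    (mean_scheme (2 ^ k)).2 x @[k --> \oo] --> z}.
  move=> x; apply/cid/(main _ (fun k w => (Zk (2 ^ k) w).2 x)).
  - by move=> k; exact: (mean_schemeP _ _).2.
  - by move=> k w; exact: (Zk_bounded _ _ (K0 k)).2.
  - by apply: filterS Zk_cvg => w /(_ x)[].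
by exists (zr, zp) => x; have [? ?] := Hr x; have [? ?] := Hp x.
Qed.

End chain_means.

(** * Comparison with the heat equation *)

Section calculus.
Context {R : realType}.
Implicit Types (f phi : R -> R).

Lemma mean_value f (a b : R) : a <= b ->
  (forall x, a <= x -> x <= b -> derivable f x 1) ->
  exists c, [/\ a <= c, c <= b & f b - f a = derive1 f c * (b - a)].
Proof.
move=> ab df; have [||c] := @MVT_segment R f (derive1 f) a b ab.
- move=> x; rewrite in_itv/= => /andP[ax xb]; rewrite derive1E.
  by apply: derivableP; apply: df; exact: ltW.
- apply: derivable_within_continuous => x; rewrite in_itv/= => /andP[].
  exact: df.
- by rewrite in_itv/= => /andP[ac cb]; exists c.
Qed.

Lemma second_difference phi (u h e : R) : 0 <= h ->
  (forall v, derivable phi v 1) -> (forall v, derivable (derive1 phi) v 1) ->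
  (forall v, `|v - u| <= h ->
    `|derive1 (derive1 phi) v - derive1 (derive1 phi) u| <= e) ->
  `|phi (u + h) + phi (u - h) - 2 * phi u - h ^+ 2 * derive1 (derive1 phi) u|
    <= 2 * h ^+ 2 * e.
Proof.
move=> h0 d1 d2 osc.
pose psi (s : R) := phi (u + s) + phi (u - s) - s ^+ 2 * derive1 (derive1 phi) u.
have dpsi (s : R) : is_derive s (1 : R) psi
    (derive1 phi (u + s) - derive1 phi (u - s) - 2 * s * derive1 (derive1 phi) u).
  have D1 (v : R) : is_derive v 1 phi (derive1 phi v).
    by rewrite derive1E; exact: derivableP.
  have E1 : is_derive s (1 : R) (phi \o (fun s : R => u + s)) (derive1 phi (u + s) * 1).
    apply: is_derive1_comp; rewrite -[X in is_derive _ _ _ X]add0r.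
    exact: is_deriveD.
  have E2 : is_derive s (1 : R) (phi \o (fun s : R => u - s))
      (derive1 phi (u - s) * (-1)).
    apply: is_derive1_comp; rewrite -[X in is_derive _ _ _ X]add0r.
    exact: is_deriveD.
  have E3 : is_derive s (1 : R) (fun s : R => s ^+ 2 * derive1 (derive1 phi) u)
      (2 * s * derive1 (derive1 phi) u).
    have idD := is_derive_id s (1 : R).
    have E := is_deriveM (is_deriveM idD idD)
      (is_derive_cst (derive1 (derive1 phi) u) s (1 : R)).
    have -> : (fun s : R => s ^+ 2 * derive1 (derive1 phi) u) =
      (id * id * cst (derive1 (derive1 phi) u)).
      by apply/funext => v; rewrite expr2.
    apply: (is_derive_eq E).
    rewrite scaler0 add0r /GRing.scale/= !mulr1 mulrC; congr (_ * _).
    by rewrite mulr2n mulrDl mul1r.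
  apply: (is_derive_eq (is_deriveB (is_deriveD E1 E2) E3)).
  by rewrite mulr1 mulrN1.
have [c [c0 ch E]] := @mean_value psi 0 h h0
  (fun (s : R) _ _ => @ex_derive _ _ _ _ _ _ _ (dpsi s)).
have -> : phi (u + h) + phi (u - h) - 2 * phi u - h ^+ 2 * derive1 (derive1 phi) u =
    psi h - psi 0.
  by rewrite /psi addr0 subr0 expr0n/= mul0r subr0; ring.
rewrite E derive1E (@derive_val _ _ _ _ _ _ _ (dpsi c)) subr0.
have [v [cv vc Ev]] : exists v, [/\ u - c <= v, v <= u + c &
    derive1 phi (u + c) - derive1 phi (u - c) =
      derive1 (derive1 phi) v * (u + c - (u - c))].
  by apply: mean_value => [|x _ _]; [lra|exact: d2].
have -> : derive1 phi (u + c) - derive1 phi (u - c)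
    - 2 * c * derive1 (derive1 phi) u =
  2 * c * (derive1 (derive1 phi) v - derive1 (derive1 phi) u) by rewrite Ev; ring.
have vu : `|v - u| <= h by rewrite ler_distl; apply/andP; split; lra.
have := osc v vu; move: (_ - _) => X Xe.
have e0 : 0 <= e by exact: le_trans Xe.
rewrite !normrM (ger0_norm h0) (ger0_norm c0) [`|2|]ger0_norm//.
have : c * `|X| <= h * e by rewrite ler_pM.
have := normr_ge0 X; nra.
Qed.

Lemma heine_cantor (g : R * R -> R) (a b c d : R) (e : R) : 0 < e ->
  (forall z, z \in `[a, b] `*` `[c, d] ->
    g y @[y --> within (`[a, b] `*` `[c, d]) (nbhs z)] --> g z) ->
  exists2 h, 0 < h & forall s u s' u',
    s \in `[a, b] -> s' \in `[a, b] -> u \in `[c, d] -> u' \in `[c, d] ->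
    `|s - s'| < h -> `|u - u'| < h -> `|g (s, u) - g (s', u')| <= e.
Proof.
move=> e0 cg; set K := _ `*` _ in cg.
have cK : compact K by apply: compact_setX; exact: segment_compact.
move/compact_near_coveringP/near_covering_withinP : cK.
pose Q (h : R) (z : R * R) := forall z', K z' -> `|z.1 - z'.1| < h ->
   `|z.2 - z'.2| < h -> `|g z - g z'| <= e.
move=> /(_ _ (0 : R)^'+ Q); case.
- move=> z Kz; have /cvgrPdist_lt/(_ (e / 2)) := cg z (mem_set Kz).
  rewrite divr_gt0// => /(_ isT); rewrite near_withinE => /nbhs_ballP[h /= h0 H].
  exists (ball z (h / 2), [set x | x < h / 2]); first split => /=.
  + by apply: nbhsx_ballx; rewrite divr_gt0.
  + by apply: nbhs_right_lt; rewrite divr_gt0.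
  move=> [z1 x] /= [[b1 b2] xh] Kz1 z' Kz' d1 d2.
  rewrite /ball/= in b1 b2.
  have Hz1 : `|g z - g z1| < e / 2.
    by apply: (H z1) => //; split; rewrite /ball/=; lra.
  have Hz' : `|g z - g z'| < e / 2.
    apply: (H z') => //; split; rewrite /ball/=.
      by have := ler_normD (z.1 - z1.1) (z1.1 - z'.1); rewrite subrKA; lra.
    by have := ler_normD (z.2 - z1.2) (z1.2 - z'.2); rewrite subrKA; lra.
  rewrite distrC in Hz1.
  by have := ler_normD (g z1 - g z) (g z - g z'); rewrite subrKA; lra.
move=> h /= h0 H.
have [x [x0 Hx]] : exists x, 0 < x /\ K `<=` Q x.
  exists (h / 2); split; first by rewrite divr_gt0.
  by apply: H; rewrite ?divr_gt0//= /ball/= sub0r normrN gtr0_norm ?divr_gt0//; lra.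
exists x => // s u s' u' ss ss' uu uu'.
by move=> h1 h2; apply: (Hx (s, u)) => //; split.
Qed.

End calculus.

Section heat_consistency.
Context {R : realType}.
Variables (gamma : R) (r0 : R -> R) (rho : R -> R -> R).
Hypothesis gamma_gt0 : 0 < gamma.
Hypothesis heat : heat_solution (2 * gamma)^-1 r0 rho.

Definition heat_modulus (a b eta delta : R) : Prop :=
  forall s u s' u', s \in `[a, b] -> s' \in `[a, b] ->
    u \in `[-1, 2] -> u' \in `[-1, 2] ->
    `|s - s'| < delta -> `|u - u'| < delta ->
  [/\ `|rho s u - rho s' u'| <= eta,
      `|derive1 (rho^~ u) s - derive1 (rho^~ u') s'| <= eta &
      `|derive1 (derive1 (rho s)) u - derive1 (derive1 (rho s')) u'| <= eta].

Lemma heat_modulus_ex (a b eta : R) : 0 < a -> 0 < eta ->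
  exists2 delta, 0 < delta & heat_modulus a b eta delta.
Proof.
move=> a0 eta0; have [_ cont smooth _ _] := heat.
have pos z : z \in `[a, b] `*` `[-1, 2] -> 0 < z.1.
  by rewrite inE => -[/=]; rewrite in_itv/= => /andP[/(lt_le_trans a0)].
have [h1 h10 H1] : exists2 h, 0 < h & forall s u s' u',
    s \in `[a, b] -> s' \in `[a, b] -> u \in `[-1, 2] -> u' \in `[-1, 2] ->
    `|s - s'| < h -> `|u - u'| < h -> `|rho s u - rho s' u'| <= eta.
  apply: (@heine_cantor _ (fun z => rho z.1 z.2)) => // z Kz.
  have /subspace_continuousP/(_ z (set_mem Kz)) : {within `[a, b] `*` `[-1, 2],
      continuous (fun z : R * R => rho z.1 z.2)}.
    by apply: continuous_subspaceW cont => y /mem_set/pos/ltW.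
  exact.
have [h2 h20 H2] : exists2 h, 0 < h & forall s u s' u',
    s \in `[a, b] -> s' \in `[a, b] -> u \in `[-1, 2] -> u' \in `[-1, 2] ->
    `|s - s'| < h -> `|u - u'| < h ->
    `|derive1 (rho^~ u) s - derive1 (rho^~ u') s'| <= eta.
  apply: (@heine_cantor _ (fun z => derive1 (rho^~ z.2) z.1)) => // -[s u] /pos z0.
  have [_ [+ _ _]] := smooth s u z0.
  exact: cvg_within_filter.
have [h3 h30 H3] : exists2 h, 0 < h & forall s u s' u',
    s \in `[a, b] -> s' \in `[a, b] -> u \in `[-1, 2] -> u' \in `[-1, 2] ->
    `|s - s'| < h -> `|u - u'| < h ->
    `|derive1 (derive1 (rho s)) u - derive1 (derive1 (rho s')) u'| <= eta.
  apply: (@heine_cantor _ (fun z => derive1 (derive1 (rho z.1)) z.2)) => //.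
  move=> [s u] /pos z0.
  have [_ [_ _ +]] := smooth s u z0.
  exact: cvg_within_filter.
exists (Num.min h1 (Num.min h2 h3)); first by rewrite !lt_min h10 h20.
move=> s u s' u' ss ss' uu uu'; rewrite !lt_min => /and3P[a1 a2 a3] /and3P[b1 b2 b3].
by split; [exact: H1|exact: H2|exact: H3].
Qed.

Definition heat_profile (n : nat) (s : R) : ('I_n -> R) * ('I_n -> R) :=
  (fun x : 'I_n => rho s (x%:R / n%:R),
   fun x : 'I_n => (2 * gamma)^-1 * (rho s ((ordS x)%:R / n%:R) - rho s (x%:R / n%:R))).

Lemma periodic_ordS n (f : R -> R) (x : 'I_n) : periodic1 f ->
  f ((ordS x)%:R / n%:R) = f (x%:R / n%:R + n%:R^-1).
Proof.
move=> pf; have n0 : (0 < n)%N by case: n x => [[]|].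
have n0' : n%:R != 0 :> R by rewrite pnatr_eq0 -lt0n.
rewrite -[X in _ = f (_ + X)]mul1r -mulrDl natr1 /=.
have := ltn_ord x; rewrite leq_eqVlt => /predU1P[xn|xn]; last by rewrite modn_small.
by rewrite xn modnn mul0r divff// -(pf 0) add0r.
Qed.

Lemma periodic_ord_pred n (f : R -> R) (x : 'I_n) : periodic1 f ->
  f ((ord_pred x)%:R / n%:R) = f (x%:R / n%:R - n%:R^-1).
Proof.
move=> pf; rewrite -{2}[x]ord_predK -[RHS]pf.
have n0 : (0 < n)%N by case: n x => [[]|].
have n0' : n%:R != 0 :> R by rewrite pnatr_eq0 -lt0n.
have -> : (ordS (ord_pred x))%:R / n%:R - n%:R^-1 + 1 =
  (ordS (ord_pred x))%:R / n%:R + (1 - n%:R^-1) :> R by ring.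
pose g (u : R) := f (u + (1 - n%:R^-1)).
have pg : periodic1 g by move=> u; rewrite /g addrAC pf.
rewrite -/(g _) periodic_ordS// /g -[LHS]pf; congr f; ring.
Qed.

Lemma heat_step_consistency n (x : 'I_n) (a b eta delta s h q : R) :
  0 < a -> heat_modulus a b eta delta -> 0 <= h ->
  a <= s -> s + h <= b -> n%:R^-1 < delta -> h < delta ->
  let A := gamma * n%:R ^+ 2 * h in
  `|q - A| <= A ^+ 2 -> A <= 1 -> gamma ^+ 2 * n%:R ^+ 4 * h <= 1 ->
  let F := heat_profile n in
  let G := flip_step (n%:R ^+ 2 * h) (fun=> 1 - 2 * q) (F s) in
  `|(F (s + h)).1 x - G.1 x| <= h * (eta * (1 + 6 / gamma)) /\
  `|(F (s + h)).2 x - G.2 x| <= h * (eta * (1 + 6 / gamma)).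
Proof.
move=> a0 mod h0 as_ shb nd hd A qA A1 Ah F G.
have [per _ smooth pde _] := heat.
have n0 : (0 < n)%N by case: (n) x => [[]|].
have nR : 0 < n%:R :> R by rewrite ltr0n.
have ni : 0 < n%:R^-1 :> R by rewrite invr_gt0.
have ni1 : n%:R^-1 <= 1 :> R by rewrite invf_le1// ler1n.
have s0 : 0 < s by exact: lt_le_trans as_.
have pers v : a <= v -> periodic1 (rho v) by move=> av; apply/per/ltW/(lt_le_trans a0).
have F1 v y : (F v).1 y = rho v (y%:R / n%:R) by [].
have F2 v y : a <= v -> (F v).2 y =
    (2 * gamma)^-1 * (rho v (y%:R / n%:R + n%:R^-1) - rho v (y%:R / n%:R)).
  by move=> av; rewrite -(periodic_ordS y (pers v av)).
have F2p y : (F s).2 (ord_pred y) =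
    (2 * gamma)^-1 * (rho s (y%:R / n%:R) - rho s (y%:R / n%:R - n%:R^-1)).
  transitivity ((2 * gamma)^-1 * (rho s ((ordS (ord_pred y))%:R / n%:R)
    - rho s ((ord_pred y)%:R / n%:R))); first by [].
  by rewrite ord_predK (periodic_ord_pred y (pers s as_)).
have G1 : G.1 x = (F s).1 x + n%:R ^+ 2 * h * ((F s).2 x - (F s).2 (ord_pred x)).
  by [].
have G2 : G.2 x =
  (1 - 2 * q) * ((F s).2 x + n%:R ^+ 2 * h * ((F s).1 (ordS x) - (F s).1 x)) by [].
set u := x%:R / n%:R : R.
have u0 : 0 <= u by rewrite divr_ge0.
have u1 : u <= 1 by rewrite ler_pdivrMr// mul1r ler_nat ltnW.
have itv v : -1 <= v -> v <= 2 -> v \in `[-1, 2] by rewrite in_itv/= => -> ->.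
have uK : u \in `[-1, 2] by apply: itv; lra.
have upK : u + n%:R^-1 \in `[-1, 2] by apply: itv; lra.
have sitv v : a <= v -> v <= b -> v \in `[a, b] by rewrite in_itv/= => -> ->.
have sK : s \in `[a, b] by apply: sitv => //; lra.
have delta0 : 0 < delta by exact: lt_trans nd.
have eta0 : 0 <= eta.
  have [H _ _] := mod s u s u sK sK uK uK (ltac:(by rewrite subrr normr0))
    (ltac:(by rewrite subrr normr0)).
  exact: le_trans H.
have gi : 0 < gamma^-1 by rewrite invr_gt0.
have g2 : (2 * gamma)^-1 = gamma^-1 / 2 by rewrite invfM mulrC.
have time_diff (phi : R -> R) : (forall v, a <= v -> v <= b -> derivable phi v 1) ->
    exists c, [/\ s <= c, c <= s + h & phi (s + h) - phi s = derive1 phi c * h].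
  move=> dphi; have [||c [c1 c2 E]] := @mean_value _ phi s (s + h).
  - by rewrite lerDl.
  - by move=> v sv vs; apply: dphi; [exact: le_trans sv|exact: le_trans shb].
  - by exists c; split=> //; rewrite E addrAC subrr add0r.
have drho v w : a <= v -> derivable (rho^~ w) v 1.
  by move=> av; have [[]] := smooth v w (lt_le_trans a0 av).
have near_s c : s <= c -> c <= s + h -> `|c - s| < delta /\ c \in `[a, b].
  move=> sc cs; split; last by apply: sitv; [exact: le_trans sc|exact: le_trans shb].
  by rewrite ger0_norm ?subr_ge0//; lra.
split.
- have -> : G.1 x = rho s u + n%:R ^+ 2 * h * (2 * gamma)^-1 *
      (rho s (u + n%:R^-1) + rho s (u - n%:R^-1) - 2 * rho s u).
    by rewrite G1 F2p F2// F1 -/u; ring.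
  have [c [sc cs E]] := time_diff (rho^~ u) (fun v av _ => drho v u av).
  have [cd cK] := near_s c sc cs.
  have uu0 : `|u - u| < delta by rewrite subrr normr0.
  have [_ Et _] := mod c u s u cK sK uK uK cd uu0.
  have dd1 v : derivable (rho s) v 1 by have [[]] := smooth s v s0.
  have dd2 v : derivable (derive1 (rho s)) v 1 by have [[]] := smooth s v s0.
  have := @second_difference _ (rho s) u n%:R^-1 eta (ltW ni) dd1 dd2.
  have /[swap]/[apply] Eu : forall v, `|v - u| <= n%:R^-1 ->
      `|derive1 (derive1 (rho s)) v - derive1 (derive1 (rho s)) u| <= eta.
    move=> v vu; have vK : v \in `[-1, 2].
      by move: vu; rewrite ler_distl => /andP[? ?]; apply: itv; lra.
    have ss0 : `|s - s| < delta by rewrite subrr normr0.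
    by have [] := mod s v s u sK sK vK uK ss0 (le_lt_trans vu nd).
  have P := pde s u s0; rewrite -[derive1n 2 _]/(derive1 (derive1 (rho s))) in P.
  move: E Et Eu; rewrite F1 -/u P.
  set D := derive1 (derive1 (rho s)) u; set X := _ - 2 * _.
  set Tc := derive1 _ c => E Et Eu.
  rewrite (_ : _ - _ = h * ((Tc - (2 * gamma)^-1 * D) -
    (2 * gamma)^-1 * (n%:R ^+ 2 * (X - n%:R^-1 ^+ 2 * D)))); last first.
    have -> : rho (s + h) u = rho s u + Tc * h by rewrite -E; ring.
    by field; rewrite ?gt_eqF.
  rewrite normrM (ger0_norm h0) ler_wpM2l//.
  apply: (le_trans (ler_normB _ _)).
  rewrite normrM gtr0_norm ?invr_gt0 ?mulr_gt0//.
  have : `|n%:R ^+ 2 * (X - n%:R^-1 ^+ 2 * D)| <= 2 * eta.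
    rewrite normrM ger0_norm ?exprn_ge0//.
    apply: (le_trans (ler_wpM2l _ Eu)); first by rewrite exprn_ge0.
    by rewrite le_eqVlt; apply/orP; left; apply/eqP; field; rewrite gt_eqF.
  move=> /(ler_wpM2l (ltW gi)); move: Et; rewrite g2.
  have : 0 <= gamma^-1 * eta by rewrite mulr_ge0// ltW.
  lra.
- pose phi v := rho v (u + n%:R^-1) - rho v u.
  have dphi v : a <= v -> is_derive v (1 : R) phi
      (derive1 (rho^~ (u + n%:R^-1)) v - derive1 (rho^~ u) v).
    by move=> av; rewrite !derive1E; apply: is_deriveB; apply: derivableP; exact: drho.
  have [c [sc cs E]] := time_diff phi
    (fun v av _ => @ex_derive _ _ _ _ _ _ _ (dphi v av)).
  have ac : a <= c by exact: le_trans sc.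
  rewrite derive1E (@derive_val _ _ _ _ _ _ _ (dphi c ac)) in E.
  have [cd cK] := near_s c sc cs.
  have uu : `|u + n%:R^-1 - u| < delta by rewrite addrAC subrr add0r gtr0_norm.
  have cc0 : `|c - c| < delta by rewrite subrr normr0.
  have ss0 : `|s - s| < delta by rewrite subrr normr0.
  have [_ Et _] := mod c _ c u cK cK upK uK cc0 uu.
  have [E0 _ _] := mod s _ s u sK sK upK uK ss0 uu.
  have -> : G.2 x = (1 - 2 * q) * (1 + 2 * A) * ((2 * gamma)^-1 * phi s).
    rewrite G2 F2// !F1 (periodic_ordS x (pers s as_)) -/u -/(phi s) /A.
    by field; rewrite gt_eqF.
  have -> : (F (s + h)).2 x = (2 * gamma)^-1 * phi (s + h).
    by rewrite F2//; apply: le_trans as_ _; rewrite lerDl.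
  set Tc := derive1 _ _ - _ in E Et.
  rewrite (_ : _ - _ = (2 * gamma)^-1 * (h * Tc -
    ((1 - 2 * q) * (1 + 2 * A) - 1) * phi s)); last first.
    have -> : phi (s + h) = phi s + Tc * h by rewrite -E; ring.
    by ring.
  rewrite normrM gtr0_norm ?invr_gt0 ?mulr_gt0//.
  have A0 : 0 <= A by rewrite /A !mulr_ge0 ?exprn_ge0// ltW.
  have B1 : `|(1 - 2 * q) * (1 + 2 * A) - 1| <= 10 * A ^+ 2.
    move: qA; rewrite ler_distl => /andP[q1 q2].
    by rewrite ler_norml; apply/andP; split; nra.
  have B2 : A ^+ 2 <= h.
    rewrite (_ : A ^+ 2 = gamma ^+ 2 * n%:R ^+ 4 * h * h); last by rewrite /A; ring.
    by rewrite -[leRHS]mul1r ler_wpM2r.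
  have B3 : `|((1 - 2 * q) * (1 + 2 * A) - 1) * phi s| <= 10 * h * eta.
    by rewrite normrM; apply: ler_pM => //; lra.
  have B4 : `|h * Tc| <= h * eta by rewrite normrM ger0_norm// ler_wpM2l.
  have B5 := ler_normB (h * Tc) (((1 - 2 * q) * (1 + 2 * A) - 1) * phi s).
  have : `|h * Tc - ((1 - 2 * q) * (1 + 2 * A) - 1) * phi s| <= 11 * (h * eta) by lra.
  move=> /(ler_wpM2l (ltW gi)); rewrite g2.
  have : 0 <= gamma^-1 * (h * eta) by rewrite !mulr_ge0// ltW.
  have : 0 <= h * eta by rewrite mulr_ge0.
  lra.
Qed.

End heat_consistency.

Section mean_energy.
Context {d : measure_display} {T : measurableType d} {R : realType} {n : nat}.
Variables (gamma : R) (mu0 : probability (n.-tuple R * n.-tuple R)%type R).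
Variables (P : probability T R).
Variables (N : 'I_n -> R -> {RV P >-> nat}) (r p : 'I_n -> R -> {RV P >-> R}).
Hypothesis n_gt0 : (0 < n)%N.
Hypothesis gamma_gt0 : 0 < gamma.
Hypothesis chain : flip_chain gamma mu0 N r p.
Variable t : R.
Hypothesis t_ge0 : 0 <= t.
Variables (r0 : R -> R) (rho : R -> R -> R).
Hypothesis heat : heat_solution (2 * gamma)^-1 r0 rho.
Variables (a eta delta : R).
Hypothesis a_gt0 : 0 < a.
Hypothesis modulus : heat_modulus rho a (a + t) eta delta.
Hypothesis n_large : n%:R^-1 < delta.
Variable m : ('I_n -> R) * ('I_n -> R).

Let F := heat_profile gamma rho n.

Let dist_energy (z : ('I_n -> R) * ('I_n -> R)) (s : R) : R :=
  energy (fun x => z.1 x - (F s).1 x, fun x => z.2 x - (F s).2 x).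

Let bound : R := expR (t + 1) *
  (dist_energy m a + 4 * t * (eta * (1 + 6 / gamma)) ^+ 2 * n%:R).

Lemma mean_scheme_energy K (h := t / K%:R) : (0 < K)%N ->
  h < delta -> h <= 1 -> gamma * n%:R ^+ 2 * h <= 1 ->
  gamma ^+ 2 * n%:R ^+ 4 * h <= 1 -> 4 * n%:R ^+ 4 * t * h <= 1 ->
  dist_energy (mean_scheme gamma N t m K) (a + t) <= bound.
Proof.
move=> K0 hd h1 A1 A2 A3.
have K0' : 0 < K%:R :> R by rewrite ltr0n.
have h0 : 0 <= h by rewrite divr_ge0// ltW.
have hK : h * K%:R = t by rewrite /h divfK// gt_eqF.
pose e := eta * (1 + 6 / gamma).
pose c := n%:R ^+ 2 * h.
pose q := flip_prob N (flip_rate (n := n) gamma t K).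
have [pois _ _ _] := chain.
have rate0 : 0 <= flip_rate (n := n) gamma t K.
  exact: (flip_rate_ge0 (ltW gamma_gt0) t_ge0 K).
have qb i := flip_prob_bounds rate0 pois i.
pose z j := flip_scheme c (fun i y => 1 - 2 * q (i, y)) m j.
pose B := (1 + h) * (1 + 4 * c ^+ 2).
pose beta := 2 * (h + h ^+ 2) * e ^+ 2 * n%:R.
have hh : 0 <= h + h ^+ 2 by rewrite addr_ge0 ?sqr_ge0.
have beta0 : 0 <= beta.
  by apply: mulr_ge0 => //; apply: mulr_ge0; [apply: mulr_ge0|exact: sqr_ge0].
have B1 : 1 <= B.
  have : 0 <= 4 * c ^+ 2 by rewrite mulr_ge0 ?sqr_ge0.
  by rewrite /B; nra.
have ind j : (j <= K)%N ->
    dist_energy (z j) (a + h * j%:R) <= B ^+ j * (dist_energy m a + j%:R * beta).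
  elim: j => [_|j IH jK]; first by rewrite !mulr0 mul0r expr0 mul1r !addr0.
  have {}IH := IH (ltnW jK).
  pose s (y : 'I_n) : R := 1 - 2 * q (j, y).
  have s1 y : `|s y| <= 1.
    by have [? ? _] := qb (j, y); rewrite /s /q ler_norml; apply/andP; split; lra.
  have ajs : a <= a + h * j%:R by rewrite lerDl; apply: mulr_ge0.
  have ajt : a + h * j%:R + h <= a + t.
    rewrite -addrA lerD2l -{2}[h]mulr1 -mulrDr natr1 -hK.
    by rewrite ler_wpM2l// ler_nat.
  have cons (y : 'I_n) := heat_step_consistency gamma_gt0 heat y a_gt0
    modulus h0 ajs ajt n_large hd (let: And3 _ _ Q := qb (j, y) in Q) A1 A2.
  have := @energy_perturbed R n c s h e (z j) (F (a + h * j%:R))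
    (F (a + h * j%:R + h)) h0 s1 (fun y => (cons y).1) (fun y => (cons y).2).
  have -> : a + h * j%:R + h = a + h * j.+1%:R by rewrite -natr1; ring.
  move=> H; apply: (le_trans H); rewrite -/beta -/B.
  apply: (@le_trans _ _ (B * (B ^+ j * (dist_energy m a + j%:R * beta)) + beta)).
    by rewrite lerD2r ler_wpM2l// (le_trans _ B1).
  rewrite mulrA -exprS -natr1 mulrDl mul1r addrA [leRHS]mulrDr lerD2l.
  by rewrite ler_peMl// exprn_ege1.
have := ind K (leqnn K); rewrite [h * _]hK => H.
apply: (le_trans H); rewrite /bound -/e.
have BK : B ^+ K <= expR (t + 1).
  rewrite /B exprMn.
  apply: (@le_trans _ _ (expR (h * K%:R) * expR (4 * c ^+ 2 * K%:R))).
    by apply: ler_pM; rewrite ?exprn_ge0 ?addr_ge0 ?mulr_ge0 ?sqr_ge0//;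
      apply: expR_ge_pow; rewrite ?mulr_ge0 ?sqr_ge0.
  rewrite -expRD ler_expR hK lerD2l; apply: le_trans A3.
  by rewrite -hK /c le_eqVlt; apply/orP; left; apply/eqP; ring.
have E0 : 0 <= dist_energy m a by exact: energy_ge0.
apply: ler_pM => //.
- by rewrite exprn_ge0// (le_trans _ B1).
- by rewrite addr_ge0// mulr_ge0.
rewrite lerD2l /beta.
have -> : K%:R * (2 * (h + h ^+ 2) * e ^+ 2 * n%:R) =
   2 * t * (e ^+ 2 * n%:R) * (1 + h) by rewrite -hK; ring.
have : 0 <= t * (e ^+ 2 * n%:R).
  by apply: mulr_ge0 => //; apply: mulr_ge0; rewrite ?sqr_ge0.
by nra.
Qed.

Lemma mean_limit_energy (z : ('I_n -> R) * ('I_n -> R)) :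
  (forall x, (mean_scheme gamma N t m (2 ^ k)).1 x @[k --> \oo] --> z.1 x) ->
  (forall x, (mean_scheme gamma N t m (2 ^ k)).2 x @[k --> \oo] --> z.2 x) ->
  dist_energy z (a + t) <= bound.
Proof.
move=> z1 z2.
have cv : dist_energy (mean_scheme gamma N t m (2 ^ k)) (a + t) @[k --> \oo]
    --> dist_energy z (a + t).
  rewrite /dist_energy /energy /=.
  apply: cvg_big => [|x _]; first exact: add_continuous.
  apply: cvgD; rewrite !expr2; under eq_fun do rewrite expr2.
    by apply: cvgM; apply: cvgB => //; exact: cvg_cst.
  by apply: cvgM; apply: cvgB => //; exact: cvg_cst.
apply: (ler_cvg_to cv (cvg_cst bound)).
have d0 : 0 < delta by apply: lt_trans n_large; rewrite invr_gt0 ltr0n.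
pose kap := gamma * n%:R ^+ 2 + gamma ^+ 2 * n%:R ^+ 4 + 4 * n%:R ^+ 4 * t
  + 1 + delta^-1.
have k1 : 0 <= gamma * n%:R ^+ 2 by rewrite mulr_ge0 ?exprn_ge0// ltW.
have k2 : 0 <= gamma ^+ 2 * n%:R ^+ 4 by rewrite mulr_ge0 ?exprn_ge0// ltW.
have k3 : 0 <= 4 * n%:R ^+ 4 * t by rewrite !mulr_ge0 ?exprn_ge0.
have k4 : 0 < delta^-1 by rewrite invr_gt0.
have kap0 : 0 < kap by rewrite /kap; lra.
have /cvgrPdist_lt/(_ kap^-1) : t / (2 ^ k)%:R @[k --> \oo] --> (0 : R).
  apply: (@cvg_dyadic_dist _ _ _ t); near=> k.
  by rewrite sub0r normrN ger0_norm// divr_ge0.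
rewrite invr_gt0 => /(_ kap0) Hk; near=> k.
have : `|0 - t / (2 ^ k)%:R| < kap^-1 by near: k.
rewrite sub0r normrN ger0_norm ?divr_ge0// => hk.
have h0 : 0 <= t / (2 ^ k)%:R by rewrite divr_ge0.
have {}hk : kap * (t / (2 ^ k)%:R) < 1.
  by rewrite -ltr_pdivlMl// mulr1.
have small x : 0 <= x -> x <= kap -> x * (t / (2 ^ k)%:R) <= 1.
  by move=> x0 xk; apply: le_trans (ltW hk); rewrite ler_wpM2r.
apply: mean_scheme_energy; rewrite ?expn_gt0//.
- rewrite -(ltr_pM2l k4) mulVf ?gt_eqF//; apply: le_lt_trans hk.
  by rewrite ler_wpM2r// /kap; lra.
- by rewrite -[leLHS]mul1r; apply: small; rewrite /kap; lra.
- by apply: small; rewrite /kap; lra.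
- by apply: small; rewrite /kap; lra.
- by apply: small; rewrite /kap; lra.
Unshelve. all: by end_near. Qed.

End mean_energy.

Lemma continuous_cadlag {R : realType} (f : R -> R) : continuous f -> cadlag f.
Proof.
move=> cf s s0; split.
  by apply: cvg_within_filter; exact: cf.
by move=> _; apply/cvg_ex; exists (f s); apply: cvg_within_filter; exact: cf.
Qed.

Lemma uniformly_continuous {R : realType} (f : R -> R) (a b e : R) :
  continuous f -> 0 < e ->
  exists2 h, 0 < h & forall u v, u \in `[a, b] -> v \in `[a, b] ->
    `|u - v| < h -> `|f u - f v| <= e.
Proof.
move=> cf e0.
have [|h h0 H] := @heine_cantor R (fun z => f z.2) 0 0 a b e e0.
  move=> [s u] _; apply: cvg_within_filter.
  apply/cvgrPdist_lt => e' e'0; have /cvgrPdist_lt/(_ _ e'0) := cf u.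
  move=> /nbhs_ballP[h /= h0 H]; apply/nbhs_ballP; exists h => // -[s' u'] [_ uu'].
  exact: H.
exists h => // u v uK vK uv.
have z0 : (0 : R) \in `[0, 0] by rewrite in_itv/= lexx.
by apply: (H 0 u 0 v) => //; rewrite subrr normr0.
Qed.

Lemma riemann_sum_cvg {R : realType} (f : R -> R) : continuous f ->
  n%:R^-1 * \sum_(x < n) f (x%:R / n%:R) @[n --> \oo] -->
    \int[lebesgue_measure]_(u in `[0, 1]) f u.
Proof.
move=> cf; have cadf := continuous_cadlag cf.
apply/cvgrPdist_le => e e0.
have [h h0 Hh] := uniformly_continuous 0 1 cf e0.
near=> n.
have n0 : (0 < n)%N by near: n; exact: nbhs_infty_gt.
have nR : 0 < n%:R :> R by rewrite ltr0n.
have nh : n%:R^-1 < h.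
  by rewrite -[h]invrK ltf_pV2 ?posrE ?invr_gt0//; near: n; exact: nbhs_infty_gtr.
pose I (x : nat) := \int[lebesgue_measure]_(u in `[0, x%:R / n%:R]) f u.
have -> : \int[lebesgue_measure]_(u in `[0, 1]) f u = \sum_(x < n) (I x.+1 - I x).
  rewrite -(big_mkord xpredT (fun x => I x.+1 - I x)) telescope_sumr// /I.
  by rewrite mul0r divff ?gt_eqF// set_itv1 Rintegral_set1 subr0.
rewrite mulr_sumr -sumrB; apply: (le_trans (ler_norm_sum _ _ _)).
have step (x : 'I_n) : `|I x.+1 - I x - n%:R^-1 * f (x%:R / n%:R)| <= n%:R^-1 * e.
  have dx : x.+1%:R / n%:R - x%:R / n%:R = n%:R^-1 :> R.
    by rewrite -mulrBl -natrB// subSnn mul1r.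
  have x1 : x.+1%:R / n%:R <= 1 :> R by rewrite ler_pdivrMr// mul1r ler_nat.
  have x0 : 0 <= x%:R / n%:R :> R by rewrite divr_ge0.
  have xx : x%:R / n%:R <= x.+1%:R / n%:R :> R.
    by rewrite ler_wpM2r ?invr_ge0 ?ler_nat// ltW.
  have := @cadlag_Rintegral_dist R f _ _ (f (x%:R / n%:R)) e cadf x0 xx.
  rewrite dx; apply; move=> s sx xs; apply: Hh; rewrite ?in_itv/=.
  - by apply/andP; split; [exact: le_trans sx|exact: le_trans x1].
  - by apply/andP; split; [exact: x0|exact: le_trans sx (le_trans xs x1)].
  - by rewrite ger0_norm ?subr_ge0//; lra.
apply: (le_trans (ler_sum _ (fun x _ => step x))).
by rewrite sumr_const card_ord -[leLHS]mulr_natr mulrAC mulVf ?mul1r// gt_eqF.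
Unshelve. all: by end_near. Qed.

Section heat_profile_limit.
Context {R : realType}.
Variables (gamma : R) (gamma_gt0 : 0 < gamma) (r0 : R -> R).
Variables (mu : forall n : nat, probability (n.-tuple R * n.-tuple R)%type R).
Variables (d : nat -> measure_display) (Omega : forall n, measurableType (d n)).
Variables (P : forall n, probability (Omega n) R).
Variables (N : forall n, 'I_n -> R -> {RV (P n) >-> nat}).
Variables (r p : forall n, 'I_n -> R -> {RV (P n) >-> R}).
Hypothesis chain : forall n, (0 < n)%N ->
  flip_chain gamma (mu n) (@N n) (@r n) (@p n).
Variables (rho : R -> R -> R) (heat : heat_solution (2 * gamma)^-1 r0 rho).
Variables (t : R) (t_ge0 : 0 <= t).

Let m n : ('I_n -> R) * ('I_n -> R) :=
  (fun x : 'I_n => r0 (x%:R / n%:R), fun=> 0).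

Variable z : forall n, ('I_n -> R) * ('I_n -> R).
Hypothesis zP : forall n (x : 'I_n),
  (mean_scheme gamma (@N n) t (@m n) (2 ^ k)).1 x @[k --> \oo] --> (z n).1 x /\
  (mean_scheme gamma (@N n) t (@m n) (2 ^ k)).2 x @[k --> \oo] --> (z n).2 x.

Lemma heat_slice_continuous (s : R) : 0 <= s -> continuous (rho s).
Proof.
move=> s0 u; have [_ cont _ _ _] := heat.
have /subspace_continuousP/(_ (s, u) s0)/cvgrPdist_lt H := cont.
apply/cvgrPdist_lt => e /H; rewrite near_withinE => /nbhs_ballP[h /= h0 Hh].
apply/nbhs_ballP; exists h => // v uv.
by apply: (Hh (s, v)) => //; split => //; exact: ballxx.
Qed.

Lemma heat_time_modulus (e : R) : 0 < e -> exists2 h, 0 < h & forall s s' u,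
  s \in `[0, t + 1] -> s' \in `[0, t + 1] -> u \in `[0, 1] ->
  `|s - s'| < h -> `|rho s u - rho s' u| <= e.
Proof.
move=> e0; have [_ cont _ _ _] := heat.
have [|h h0 H] := @heine_cantor R (fun y => rho y.1 y.2) 0 (t + 1) 0 1 e e0.
  move=> y Ky; have /subspace_continuousP/(_ y (set_mem Ky)) :
      {within `[0, t + 1] `*` `[0, 1], continuous (fun z : R * R => rho z.1 z.2)}.
    apply: continuous_subspaceW cont => y' [/=].
    by rewrite in_itv/= => /andP[].
  exact.
exists h => // s s' u sK s'K uK ss'.
by apply: (H s u s' u) => //; rewrite subrr normr0.
Qed.

Lemma avg_le_energy n (e : 'I_n -> R) (theta : R) : (0 < n)%N -> 0 < theta ->
  \sum_x e x ^+ 2 <= theta ^+ 2 * n%:R -> n%:R^-1 * \sum_x `|e x| <= theta.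
Proof.
move=> n0 th0 H; have nR : 0 < n%:R :> R by rewrite ltr0n.
rewrite ler_pdivrMl//.
have young x : 2 * theta * `|e x| <= e x ^+ 2 + theta ^+ 2.
  have := sqr_ge0 (`|e x| - theta); rewrite -[e x ^+ 2]real_normK ?num_real//.
  by rewrite !expr2; lra.
have : \sum_x (2 * theta * `|e x|) <= \sum_x (e x ^+ 2 + theta ^+ 2).
  by apply: ler_sum => x _; exact: young.
rewrite -mulr_sumr big_split/= sumr_const card_ord -[theta ^+ 2 *+ n]mulr_natr.
move: (\sum_x `|e x|) (\sum_x e x ^+ 2) H => S V H SV.
suff : 2 * theta * S <= 2 * theta * (n%:R * theta) by rewrite ler_pM2l// mulr_gt0.
by apply: (le_trans SV); rewrite !expr2 in H *; lra.
Qed.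

Lemma heat_profile_limit (theta : R) : 0 < theta ->
  \forall n \near \oo,
    n%:R^-1 * \sum_(x < n) `|(z n).1 x - rho t (x%:R / n%:R)| <= 2 * theta /\
    n%:R^-1 * \sum_(x < n) `|(z n).2 x| <= 2 * theta.
Proof.
move=> th0; have [per _ _ _ init] := heat.
pose C := expR (t + 1) * (1 + ((2 * gamma)^-1) ^+ 2 + 4 * t * (1 + 6 / gamma) ^+ 2).
have gi : 0 < (2 * gamma)^-1 by rewrite invr_gt0 mulr_gt0.
have C1 : 1 + ((2 * gamma)^-1) ^+ 2 <= C.
  rewrite -[leLHS]mul1r; apply: ler_pM => //.
  - by rewrite addr_ge0 ?sqr_ge0.
  - by rewrite -expR0 ler_expR addr_ge0.
  - by rewrite lerDl; apply: mulr_ge0; rewrite ?sqr_ge0 ?mulr_ge0.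
have g2 := sqr_ge0 (2 * gamma)^-1.
have C0 : 1 <= C by lra.
pose eta := theta / (1 + C).
have C10 : 0 < 1 + C by lra.
have eta0 : 0 < eta by rewrite divr_gt0.
have etaC : eta * (1 + C) = theta by rewrite /eta divfK// gt_eqF.
have eta_th : eta <= theta by rewrite -etaC; nra.
have etag : (2 * gamma)^-1 * eta <= theta.
  rewrite -etaC mulrC ler_wpM2l ?ltW//.
  have : (2 * gamma)^-1 <= 1 + ((2 * gamma)^-1) ^+ 2.
    by have := sqr_ge0 ((2 * gamma)^-1 - 1); rewrite !expr2; nra.
  lra.
have etaC2 : eta ^+ 2 * C <= theta ^+ 2.
  by rewrite -etaC [leRHS]exprMn ler_wpM2l ?sqr_ge0// !expr2; nra.
clearbody eta.
have [h h0 Hh] := heat_time_modulus eta0.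
pose a := Num.min (h / 2) 1.
have a0 : 0 < a by rewrite lt_min divr_gt0//=.
have a1 : a <= 1 by rewrite ge_min lexx orbT.
have ah : a < h by rewrite gt_min; apply/orP; left; lra.
have [delta delta0 mod] := heat_modulus_ex heat (a + t) a0 eta0.
near=> n.
have n0 : (0 < n)%N by near: n; exact: nbhs_infty_gt.
have nR : 0 < n%:R :> R by rewrite ltr0n.
have nd : n%:R^-1 < delta.
  by rewrite -[delta]invrK ltf_pV2 ?posrE ?invr_gt0//; near: n; exact: nbhs_infty_gtr.
have x01 (x : 'I_n) : x%:R / n%:R \in `[0 : R, 1].
  by rewrite in_itv/= divr_ge0//= ler_pdivrMr// mul1r ler_nat ltnW.
have ni1 : n%:R^-1 <= 1 :> R by rewrite invf_le1// ler1n.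
have ni0 : 0 < n%:R^-1 :> R by rewrite invr_gt0.
have grad s (x : 'I_n) : a <= s -> s <= a + t ->
    `|(heat_profile gamma rho n s).2 x| <= (2 * gamma)^-1 * eta.
  move=> as_ st; have s0 : 0 <= s by apply: le_trans as_; exact: ltW.
  have -> : (heat_profile gamma rho n s).2 x = (2 * gamma)^-1 *
      (rho s (x%:R / n%:R + n%:R^-1) - rho s (x%:R / n%:R)).
    by rewrite -(periodic_ordS x (per s s0)).
  rewrite normrM gtr0_norm// ler_wpM2l ?(ltW gi)//.
  have := x01 x; rewrite in_itv/= => /andP[u0 u1].
  have sK : s \in `[a, a + t] by rewrite in_itv/= as_.
  have [] // := mod s (x%:R / n%:R + n%:R^-1) s (x%:R / n%:R) sK sK.
  - by rewrite in_itv/=; apply/andP; split; lra.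
  - by rewrite in_itv/=; apply/andP; split; lra.
  - by rewrite subrr normr0.
  - by rewrite addrAC subrr add0r gtr0_norm.
have time s (x : 'I_n) : 0 <= s -> s <= t ->
    `|rho s (x%:R / n%:R) - rho (a + s) (x%:R / n%:R)| <= eta.
  move=> s0 st; apply: Hh => //; rewrite ?in_itv/=.
  - by apply/andP; split; lra.
  - by apply/andP; split; lra.
  - by rewrite opprD addrCA subrr addr0 normrN gtr0_norm.
have E := mean_limit_energy n0 gamma_gt0 (chain n0) t_ge0 heat a0 mod nd
  (fun x => (zP x).1) (fun x => (zP x).2).
have Em : energy (fun x => (@m n).1 x - (heat_profile gamma rho n a).1 x,
    fun x => (@m n).2 x - (heat_profile gamma rho n a).2 x) <=
    eta ^+ 2 * (1 + ((2 * gamma)^-1) ^+ 2) * n%:R.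
  rewrite mulr_natr -[X in _ *+ X]card_ord -sumr_const; apply: ler_sum => x _.
  rewrite [leRHS](_ : _ = eta ^+ 2 + ((2 * gamma)^-1 * eta) ^+ 2); last by ring.
  have sq (u v : R) : `|u| <= v -> u ^+ 2 <= v ^+ 2.
    move=> uv; rewrite -real_normK ?num_real// lerXn2r// nnegrE.
    exact: le_trans uv.
  apply: lerD; apply: sq.
    by have := time 0 x (lexx 0) t_ge0; rewrite addr0 init.
  suff : `|0 - (heat_profile gamma rho n a).2 x| <= (2 * gamma)^-1 * eta by [].
  rewrite sub0r normrN.
  by apply: grad => //; rewrite lerDl.
have {}E : energy (fun x => (z n).1 x - (heat_profile gamma rho n (a + t)).1 x,
    fun x => (z n).2 x - (heat_profile gamma rho n (a + t)).2 x) <=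
    theta ^+ 2 * n%:R.
  apply: (le_trans E); apply: (@le_trans _ _ (eta ^+ 2 * C * n%:R)); last first.
    by rewrite ler_wpM2r.
  rewrite /C [leRHS](_ : _ = expR (t + 1) *
    (eta ^+ 2 * (1 + ((2 * gamma)^-1) ^+ 2) * n%:R +
     4 * t * (eta * (1 + 6 / gamma)) ^+ 2 * n%:R)); last by ring.
  by rewrite ler_wpM2l ?expR_ge0// lerD2r.
rewrite /energy big_split/= in E.
have [E1 E2] : \sum_(x < n) ((z n).1 x - (heat_profile gamma rho n (a + t)).1 x) ^+ 2
      <= theta ^+ 2 * n%:R /\
    \sum_(x < n) ((z n).2 x - (heat_profile gamma rho n (a + t)).2 x) ^+ 2
      <= theta ^+ 2 * n%:R.
  split; apply: le_trans E; rewrite ?lerDl ?lerDr; apply: sumr_ge0 => x _;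
    exact: sqr_ge0.
have avg (e f : 'I_n -> R) : n%:R^-1 * \sum_x `|e x| <= theta ->
    (forall x, `|f x - e x| <= theta) -> n%:R^-1 * \sum_x `|f x| <= 2 * theta.
  rewrite !ler_pdivrMl// => He ef.
  apply: (@le_trans _ _ (\sum_x (`|e x| + theta))).
    apply: ler_sum => x _; rewrite -[f x](subrK (e x)) addrC.
    by rewrite (le_trans (ler_normD _ _))// lerD2l.
  rewrite big_split/= sumr_const card_ord -mulr_natr.
  by move: (\sum_i _) He => S; lra.
split.
- apply: avg (avg_le_energy n0 th0 E1) _ => x /=.
  apply: (le_trans _ eta_th); apply: (le_trans _ (time t x t_ge0 (lexx t))).
  rewrite le_eqVlt; apply/orP; left; apply/eqP; rewrite distrC.
  by congr (`| _ |); rewrite /heat_profile/=; ring.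
- apply: avg (avg_le_energy n0 th0 E2) _ => x.
  rewrite opprB addrCA subrr addr0.
  by apply: le_trans etag; apply: grad; rewrite ?lerDl ?lerDr.
Unshelve. all: by end_near. Qed.

End heat_profile_limit.

(** * Hydrodynamic limit *)

Theorem theorem3p7 (R : realType) (gamma : R) (gamma_gt0 : 0 < gamma)
  (r0 : R -> R) (r0_continuous : continuous r0) (r0_periodic : periodic1 r0)
  (mu : forall n : nat, probability (n.-tuple R * n.-tuple R)%type R)
  (d : nat -> measure_display) (Omega : forall n, measurableType (d n))
  (P : forall n, probability (Omega n) R)
  (N : forall n, 'I_n -> R -> {RV (P n) >-> nat})
  (r p : forall n, 'I_n -> R -> {RV (P n) >-> R})
  (chain : forall n, (0 < n)%N -> flip_chain gamma (mu n) (@N n) (@r n) (@p n))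
  (mean_p0 : forall n, (0 < n)%N -> forall x : 'I_n,
    ('E_(P n)[p n x 0%R] = 0)%E)
  (mean_r0 : forall n, (0 < n)%N -> forall x : 'I_n,
    ('E_(P n)[r n x 0%R] = (r0 (x%:R / n%:R)%R)%:E)%E)
  (rho : R -> R -> R) (heat : heat_solution (2 * gamma)^-1 r0 rho)
  (G : R -> R) (G_smooth : smooth G) (G_periodic : periodic1 G)
  (t : R) (t_ge0 : 0 <= t) :
  ((n%:R^-1)%R%:E * \sum_(x < n) ((G (x%:R / n%:R)%R)%:E * 'E_(P n)[p n x t]))%E
    @[n --> \oo] --> 0%E /\
  ((n%:R^-1)%R%:E * \sum_(x < n) ((G (x%:R / n%:R)%R)%:E * 'E_(P n)[r n x t]))%E
    @[n --> \oo] -->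
    (\int[lebesgue_measure]_(u in `[0, 1]) (G u * rho t u))%:E.
Proof.
pose m n : ('I_n -> R) * ('I_n -> R) := (fun x : 'I_n => r0 (x%:R / n%:R), fun=> 0).
have means n : {z : ('I_n -> R) * ('I_n -> R) | forall x : 'I_n,
    [/\ ('E_(P n)[r n x t] = (z.1 x)%:E)%E, ('E_(P n)[p n x t] = (z.2 x)%:E)%E,
      (mean_scheme gamma (@N n) t (m n) (2 ^ k)).1 x @[k --> \oo] --> z.1 x &
      (mean_scheme gamma (@N n) t (m n) (2 ^ k)).2 x @[k --> \oo] --> z.2 x]}.
  have [n0|] := ltnP 0 n; last first.
    by rewrite leqn0 => /eqP n0; exists (m n) => x; move: (ltn_ord x); rewrite {2}n0.
  apply/cid/(chain_means (ltW gamma_gt0) (chain n n0) t_ge0).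
    exact: mean_r0.
  exact: mean_p0.
pose z n := sval (means n).
have zE n (x : 'I_n) : ('E_(P n)[r n x t] = ((z n).1 x)%:E)%E /\
    ('E_(P n)[p n x t] = ((z n).2 x)%:E)%E.
  by have [] := svalP (means n) x.
have zP n (x : 'I_n) :
  (mean_scheme gamma (@N n) t (m n) (2 ^ k)).1 x @[k --> \oo] --> (z n).1 x /\
  (mean_scheme gamma (@N n) t (m n) (2 ^ k)).2 x @[k --> \oo] --> (z n).2 x.
  by have [] := svalP (means n) x.
have limit := heat_profile_limit gamma_gt0 chain heat t_ge0 zP.
have G_cont : continuous G.
  move=> u; apply: differentiable_continuous; apply/derivable1_diffP.
  exact: (G_smooth 0%N u).
have rho_cont : continuous (rho t) by exact: (heat_slice_continuous heat t_ge0).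
have [B B0 GB] := cadlag_bounded 1 (continuous_cadlag G_cont).
have G01 n (x : 'I_n) : `|G (x%:R / n%:R)| <= B.
  have nR : 0 < n%:R :> R by rewrite ltr0n; case: n x => [[]|].
  by apply: GB; rewrite ?divr_ge0// ler_pdivrMr// mul1r ler_nat ltnW.
have weighted n (e : 'I_n -> R) theta : n%:R^-1 * \sum_(x < n) `|e x| <= theta ->
    `|n%:R^-1 * \sum_(x < n) G (x%:R / n%:R) * e x| <= B * theta.
  move=> He; rewrite normrM ger0_norm ?invr_ge0//.
  apply: (@le_trans _ _ (B * (n%:R^-1 * \sum_(x < n) `|e x|))); last first.
    by rewrite ler_wpM2l.
  rewrite [leRHS]mulrCA ler_wpM2l ?invr_ge0// mulr_sumr.
  apply: (le_trans (ler_norm_sum _ _ _)); apply: ler_sum => x _.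
  by rewrite normrM ler_wpM2r.
have B1 : 0 < B + 1 by rewrite ltr_wpDl.
pose theta e := e / (2 * (B + 1)) : R.
have theta0 e : 0 < e -> 0 < theta e by move=> e0; rewrite divr_gt0// mulr_gt0.
have thetaB e : 0 < e -> B * (2 * theta e) <= e.
  move=> e0; have -> : B * (2 * theta e) = e * (B / (B + 1)).
    by rewrite /theta; field; rewrite gt_eqF.
  by rewrite ger_pMr// ler_pdivrMr// mul1r lerDl.
have lim_p : n%:R^-1 * \sum_(x < n) G (x%:R / n%:R) * (z n).2 x @[n --> \oo] -->
    (0 : R).
  apply/cvgrPdist_le => e e0; apply: filterS (limit _ (theta0 e e0)) => n [_ H].
  by rewrite sub0r normrN; apply: le_trans (thetaB e e0); exact: weighted.
have lim_r : n%:R^-1 * \sum_(x < n) G (x%:R / n%:R) * (z n).1 x @[n --> \oo] -->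
    \int[lebesgue_measure]_(u in `[0, 1]) (G u * rho t u).
  have riem : n%:R^-1 * \sum_(x < n) (G (x%:R / n%:R) * rho t (x%:R / n%:R))
      @[n --> \oo] --> \int[lebesgue_measure]_(u in `[0, 1]) (G u * rho t u).
    by apply: (riemann_sum_cvg (f := fun u => G u * rho t u)) => u; apply: cvgM;
      [exact: G_cont|exact: rho_cont].
  rewrite -[X in _ --> X]addr0.
  have -> : (fun n => n%:R^-1 * \sum_(x < n) G (x%:R / n%:R) * (z n).1 x) =
    (fun n => n%:R^-1 * \sum_(x < n) (G (x%:R / n%:R) * rho t (x%:R / n%:R)) +
      n%:R^-1 * \sum_(x < n) G (x%:R / n%:R) * ((z n).1 x - rho t (x%:R / n%:R))).
    apply/funext => n; rewrite -mulrDr -big_split/=; congr (_ * _).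
    by apply: eq_bigr => x _; ring.
  apply: cvgD riem _.
  apply/cvgrPdist_le => e e0; apply: filterS (limit _ (theta0 e e0)) => n [H _].
  by rewrite sub0r normrN; apply: le_trans (thetaB e e0); exact: weighted.
split.
- have -> : (fun n => (n%:R^-1)%:E *
      \sum_(x < n) ((G (x%:R / n%:R))%:E * 'E_(P n)[p n x t]))%E =
    (fun n => (n%:R^-1 * \sum_(x < n) G (x%:R / n%:R) * (z n).2 x)%:E).
    apply/funext => n; rewrite EFinM -sumEFin; congr (_ * _)%E.
    by apply: eq_bigr => x _; rewrite (zE n x).2 EFinM.
  by apply/fine_cvgP; split; [exact: nearW|exact: lim_p].
- have -> : (fun n => (n%:R^-1)%:E *
      \sum_(x < n) ((G (x%:R / n%:R))%:E * 'E_(P n)[r n x t]))%E =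
    (fun n => (n%:R^-1 * \sum_(x < n) G (x%:R / n%:R) * (z n).1 x)%:E).
    apply/funext => n; rewrite EFinM -sumEFin; congr (_ * _)%E.
    by apply: eq_bigr => x _; rewrite (zE n x).1 EFinM.
  by apply/fine_cvgP; split; [exact: nearW|exact: lim_r].
Qed.
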